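(* Let $x=p/q$ with $\gcd(p,q)=1$, $q\in\mathbb N$, and let $\{y_n\}_{n\in\mathbb N}$ be positive numbers. (1) If $y_n=c/n^2$ for a constant $c>0$, then for any $m\in\mathbb N_q$ and any $\Psi\in C_c^\infty(\mathcal M)$, $$\lim_{\substack{n\to\infty\\ \gcd(n,q)=1}}\delta^{\rm pr}_{n,x,y_n}(\Psi)=\mu_{\frac{1}{cq^2}}(\Psi)\quad\text{and}\quad \lim_{\substack{n\to\infty\\ n\in\mathbb P_m}}\delta_{n,x,y_n}(\Psi)=\nu_{m,\frac{\gcd(m,q)^2}{cq^2}}(\Psi).$$ (2) If $\lim_{n\to\infty}n^2y_n=0$, then both sequences $\{\mathcal R_n(x,y_n)\}_{n\in\mathbb N}$ and $\{\mathcal R_n^{\rm pr}(x,y_n)\}_{n\in\mathbb N}$ fully escape to the cusp of $\mathcal M$, i.e. for every compact $K\subset\mathcal M$, $\mathcal R_n(x,y_n)\cap K=\emptyset$ (and hence $\mathcal R^{\rm pr}_n(x,y_n)\cap K=\emptyset$) for all sufficiently large $n$.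
   Context: $\mathcal M=\Gamma\backslash\mathbb H$ with $\Gamma=\mathrm{SL}_2(\mathbb Z)$. For $n\in\mathbb N$, $x\in\mathbb R/\mathbb Z$, $y>0$: $\mathcal R_n(x,y)=\{\Gamma(x+\tfrac jn+iy):0\le j\le n-1\}$, $\mathcal R^{\rm pr}_n(x,y)=\{\Gamma(x+\tfrac jn+iy):j\in(\mathbb Z/n\mathbb Z)^\times\}$; $\delta_{n,x,y}(\Psi)=\frac1n\sum_{j=0}^{n-1}\Psi(\Gamma(x+\tfrac jn+iy))$, $\delta^{\rm pr}_{n,x,y}(\Psi)=\frac1{\varphi(n)}\sum_{j\in(\mathbb Z/n\mathbb Z)^\times}\Psi(\Gamma(x+\tfrac jn+iy))$. $\mathbb N_q=\{n\in\mathbb N:\gcd(n^2,q)\mid n\}$. For $m\in\mathbb N$, $\mathbb P_m=\{n=m\ell:\ \ell\text{ prime},\ \ell\nmid m\}$. For $Y>0$, $\mu_Y$ is the uniform probability measure on the closed horocycle $\{\Gamma(t+iY):t\in\mathbb R/\mathbb Z\}$, i.e. $\mu_Y(\Psi)=\int_0^1\Psi(t+iY)\,dt$, and $\nu_{m,Y}=\frac1m\sum_{d\mid m}\varphi(\tfrac md)\mu_{d^2Y}$. *)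

(* Defs.v *)
From Stdlib Require Import Reals Lra ZArith Znumtheory List Arith.
From Coquelicot Require Import Coquelicot.
Open Scope R_scope.

Definition inH (z : R * R) : Prop := 0 < snd z.

(* Moebius action of gamma = [[a,b],[c,d]] in SL_2(Z) on z = x + i y:
   gamma z = (a z + b)/(c z + d), written in real coordinates. *)
Definition act (a b c d : Z) (z : R * R) : R * R :=
  let x := fst z in let y := snd z in
  let den := (IZR c * x + IZR d) ^ 2 + (IZR c * y) ^ 2 in
  (((IZR a * x + IZR b) * (IZR c * x + IZR d) + IZR a * IZR c * y ^ 2) / den,
   y / den).

Definition inSL2Z (a b c d : Z) : Prop := (a * d - b * c = 1)%Z.

(* Subsets of M = Gamma\H are represented by Gamma-invariant subsets of H. *)
Definition Gamma_invariant_set (S : R * R -> Prop) : Prop :=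
  (forall z, S z -> inH z) /\
  forall a b c d, inSL2Z a b c d -> forall z, inH z -> (S (act a b c d z) <-> S z).

Definition openH (U : R * R -> Prop) : Prop :=
  (forall z, U z -> inH z) /\
  forall z, U z -> exists eps, 0 < eps /\
    forall w, (fst w - fst z) ^ 2 + (snd w - snd z) ^ 2 < eps ^ 2 -> U w.

(* Compactness in the quotient topology of M: the open sets of M are exactly
   the images of Gamma-invariant open subsets of H.  K (a Gamma-invariant subset
   of H) is compact in M iff every cover of K by Gamma-invariant open subsets of H
   has a finite subcover. *)
Definition compactM (K : R * R -> Prop) : Prop :=
  Gamma_invariant_set K /\
  forall (I : Type) (U : I -> R * R -> Prop),
    (forall i, openH (U i) /\ Gamma_invariant_set (U i)) ->
    (forall z, K z -> exists i, U i z) ->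
    exists l : list I, forall z, K z -> exists i, In i l /\ U i z.

Definition pdx (f : R -> R -> R) : R -> R -> R := fun x y => Derive (fun t => f t y) x.
Definition pdy (f : R -> R -> R) : R -> R -> R := fun x y => Derive (fun t => f x t) y.
Fixpoint pD (l : list bool) (f : R -> R -> R) : R -> R -> R :=
  match l with
  | nil => f
  | false :: l' => pdx (pD l' f)
  | true :: l' => pdy (pD l' f)
  end.

Definition smooth_on_H (f : R -> R -> R) : Prop :=
  forall l : list bool, forall x y, 0 < y ->
    ex_derive (fun t => pD l f t y) x /\ ex_derive (fun t => pD l f x t) y /\
    continuity_2d_pt (pD l f) x y.

Definition CcInf_M (Psi : R * R -> R) : Prop :=
  (forall a b c d, inSL2Z a b c d -> forall z, inH z -> Psi (act a b c d z) = Psi z) /\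
  smooth_on_H (fun x y => Psi (x, y)) /\
  exists K, compactM K /\ forall z, inH z -> ~ K z -> Psi z = 0.

Definition sumR (l : list R) : R := fold_right Rplus 0 l.

Definition units_list (n : nat) : list nat :=
  filter (fun j => Nat.eqb (Nat.gcd j n) 1) (seq 0 n).

Definition eulerphi (n : nat) : nat := length (units_list n).

Definition delta (n : nat) (x y : R) (Psi : R * R -> R) : R :=
  / INR n * sumR (map (fun j => Psi (x + INR j / INR n, y)) (seq 0 n)).

Definition delta_pr (n : nat) (x y : R) (Psi : R * R -> R) : R :=
  / INR (eulerphi n) * sumR (map (fun j => Psi (x + INR j / INR n, y)) (units_list n)).

(* uniform probability measure on the closed horocycle of height Y *)
Definition muY (Y : R) (Psi : R * R -> R) : R := RInt (fun t => Psi (t, Y)) 0 1.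

Definition divisors_list (m : nat) : list nat :=
  filter (fun d => Nat.eqb (m mod d) 0) (seq 1 m).

Definition nuY (m : nat) (Y : R) (Psi : R * R -> R) : R :=
  / INR m * sumR (map (fun d => INR (eulerphi (m / d)) * muY (INR d ^ 2 * Y) Psi)
                      (divisors_list m)).

Definition inNq (q n : nat) : Prop := Nat.divide (Nat.gcd (n * n) q) n.

Definition inPm (m n : nat) : Prop :=
  exists l : nat, prime (Z.of_nat l) /\ ~ Nat.divide l m /\ n = (m * l)%nat.

Definition lim_along (P : nat -> Prop) (u : nat -> R) (L : R) : Prop :=
  forall eps, 0 < eps -> exists N : nat, forall n, (N <= n)%nat -> P n ->
    Rabs (u n - L) < eps.

(* Main.v *)
(** Put z = p/q + j/n + iy with gcd(j,n) = gcd(n,q) = 1.  The real part has reduced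
    denominator nq, so some gamma in SL_2(Z) with bottom row (nq, -(pn+jq)) maps z to height
    1/((nq)^2 y) = 1/(cq^2) when y = c/n^2, and to real part alpha/n + beta/q, where
    q^2 j alpha = -1 mod n and p n^2 beta = -1 mod q.  As j runs over the units mod n so does
    alpha, while beta does not depend on j: the points are the reduced fractions with
    denominator n, translated, on one fixed horocycle.  Sieving a Riemann sum by the primes
    dividing n costs O(2^omega(n)), and 4^omega(n) n = O(phi(n)^2), hence equidistribution.

    For n = ml, write p/q = p1/q1 + p2/q2 with q1 = gcd(m,q).  As q1 divides n, the
    translation by p1/q1 permutes the points; as q2 is prime to m, sorting j by gcd(j,n)
    reduces to the primitive case with denominators n/d, up to the m values of j divisible
    by l.

    In general the reduced denominator of p/q + j/n is at most nq, so the orbit reaches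
    height at least 1/(n^2 q^2 y), whereas a compact subset of the quotient has bounded
    height. *)

Require Import Defs.
From Corelib Require Import ssreflect.
From Stdlib Require Import Reals Lra Lia ZArith Znumtheory List Arith Permutation Psatz.
From Coquelicot Require Import Coquelicot.
Open Scope general_if_scope.
Open Scope R_scope.

(** * Sieving by a list of primes *)

Definition sum_over {A : Type} (f : A -> R) (l : list A) : R := sumR (map f l).

Lemma sum_over_cons {A} (f : A -> R) a l : sum_over f (a :: l) = f a + sum_over f l.
Proof. reflexivity. Qed.

Lemma sum_over_app {A} (f : A -> R) l1 l2 :
  sum_over f (l1 ++ l2) = sum_over f l1 + sum_over f l2.
Proof.
  induction l1 as [|a l1 IH]; simpl; [unfold sum_over; simpl; lra|].
  rewrite !sum_over_cons IH; lra.
Qed.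

Lemma sum_over_perm {A} (f : A -> R) l1 l2 :
  Permutation l1 l2 -> sum_over f l1 = sum_over f l2.
Proof.
  induction 1; rewrite ?sum_over_cons; lra.
Qed.

Lemma sum_over_map {A B} (f : B -> R) (h : A -> B) l :
  sum_over f (map h l) = sum_over (fun a => f (h a)) l.
Proof. unfold sum_over; now rewrite map_map. Qed.

Lemma sum_over_ext_in {A} (f g : A -> R) l :
  (forall a, In a l -> f a = g a) -> sum_over f l = sum_over g l.
Proof. intros H; unfold sum_over; now rewrite (map_ext_in f g). Qed.

Lemma sum_over_plus {A} (f g : A -> R) l :
  sum_over (fun a => f a + g a) l = sum_over f l + sum_over g l.
Proof.
  induction l as [|a l IH]; [unfold sum_over; simpl; lra|].
  rewrite !sum_over_cons IH; lra.
Qed.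

Lemma sum_over_scal {A} (f : A -> R) c l :
  sum_over (fun a => c * f a) l = c * sum_over f l.
Proof.
  induction l as [|a l IH]; [unfold sum_over; simpl; lra|].
  rewrite !sum_over_cons IH; lra.
Qed.

Lemma sum_over_const {A} c (l : list A) : sum_over (fun _ => c) l = INR (length l) * c.
Proof.
  induction l as [|a l IH]; [unfold sum_over; simpl; lra|].
  rewrite sum_over_cons IH. cbn [length]. rewrite S_INR; lra.
Qed.

Lemma sum_over_abs_le {A} (f : A -> R) B l :
  (forall a, In a l -> Rabs (f a) <= B) -> Rabs (sum_over f l) <= INR (length l) * B.
Proof.
  induction l as [|a l IH]; intros H.
  - unfold sum_over; simpl; rewrite Rabs_R0; lra.
  - rewrite sum_over_cons. cbn [length]. rewrite S_INR.
    pose proof (H a (or_introl eq_refl)).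
    pose proof (IH (fun b hb => H b (or_intror hb))).
    pose proof (Rabs_triang (f a) (sum_over f l)); lra.
Qed.

Lemma sum_over_filter_split {A} (f : A -> R) (b : A -> bool) l :
  sum_over f l =
  sum_over f (filter b l) + sum_over f (filter (fun a => negb (b a)) l).
Proof.
  induction l as [|a l IH]; [unfold sum_over; simpl; lra|].
  simpl; destruct (b a); simpl; rewrite !sum_over_cons IH; lra.
Qed.

Lemma list_filter_filter {A} (f g : A -> bool) l :
  filter f (filter g l) = filter (fun a => andb (f a) (g a)) l.
Proof.
  induction l as [|a l IH]; simpl; [reflexivity|].
  destruct (g a); simpl; destruct (f a); simpl; now rewrite IH.
Qed.

Definition natprime (p : nat) : Prop := prime (Z.of_nat p).

Lemma divide_Z_nat a b : Nat.divide a b <-> (Z.of_nat a | Z.of_nat b)%Z.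
Proof.
  split.
  - intros [k ->]; exists (Z.of_nat k); lia.
  - intros [k Hk]. destruct (Nat.eq_dec a 0) as [->|Ha].
    + exists 0%nat. lia.
    + exists (Z.to_nat k). apply Nat2Z.inj. rewrite Nat2Z.inj_mul.
      rewrite Z2Nat.id; nia.
Qed.

Lemma natprime_ge2 p : natprime p -> (2 <= p)%nat.
Proof. intros H; apply prime_ge_2 in H; lia. Qed.

Lemma natprime_mult p a b :
  natprime p -> Nat.divide p (a * b) -> Nat.divide p a \/ Nat.divide p b.
Proof.
  intros Hp; rewrite !divide_Z_nat Nat2Z.inj_mul; now apply prime_mult.
Qed.

Lemma natprime_divide_prime p r : natprime p -> natprime r -> Nat.divide p r -> p = r.
Proof.
  intros Hp Hr; rewrite divide_Z_nat => H.
  apply prime_div_prime in H; trivial; lia.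
Qed.

Lemma exists_natprime_divisor n : (2 <= n)%nat -> exists p, natprime p /\ Nat.divide p n.
Proof.
  induction n as [n IH] using lt_wf_ind; intros Hn.
  destruct (prime_dec (Z.of_nat n)) as [H|H].
  - exists n; split; [exact H|apply Nat.divide_refl].
  - apply not_prime_divide in H; [|lia].
    destruct H as [d [Hd Hdiv]].
    destruct (IH (Z.to_nat d)) as [p [Hp Hpd]]; [lia|lia|].
    exists p; split; trivial. apply Nat.divide_trans with (Z.to_nat d); trivial.
    apply divide_Z_nat. rewrite Z2Nat.id; [exact Hdiv|lia].
Qed.

Definition divb (p k : nat) : bool := Nat.eqb (k mod p) 0.

Lemma divb_spec p k : (p <> 0)%nat -> divb p k = true <-> Nat.divide p k.
Proof.
  intros Hp; unfold divb; rewrite Nat.eqb_eq. now apply Nat.Lcm0.mod_divide.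
Qed.

Definition sieve (ps : list nat) (n : nat) : list nat :=
  filter (fun k => forallb (fun p => negb (divb p k)) ps) (seq 0 n).

Lemma in_sieve ps n k :
  (forall p, In p ps -> natprime p) ->
  In k (sieve ps n) <-> (k < n)%nat /\ forall p, In p ps -> ~ Nat.divide p k.
Proof.
  intros Hps; unfold sieve; rewrite filter_In in_seq forallb_forall.
  split.
  - intros [H1 H2]; split; [lia|]. intros p Hp Hd.
    specialize (H2 p Hp). apply divb_spec in Hd; [now rewrite Hd in H2|].
    apply Hps, natprime_ge2 in Hp; lia.
  - intros [H1 H2]; split; [lia|]. intros p Hp.
    destruct (divb p k) eqn:E; trivial.
    apply divb_spec in E; [|apply Hps, natprime_ge2 in Hp; lia].
    now elim (H2 p Hp).
Qed.

Lemma NoDup_sieve ps n : NoDup (sieve ps n).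
Proof. apply NoDup_filter, seq_NoDup. Qed.

(** A prime [r] of [ps] is distinct from [p], so it divides [p * k] exactly when it divides [k];
    multiplication by [p] thus carries the sieve at scale [n] onto the multiples of [p] at scale
    [p * n]. *)
Lemma sieve_multiples p ps n :
  (forall r, In r (p :: ps) -> natprime r) -> ~ In p ps ->
  Permutation (filter (divb p) (sieve ps (p * n))) (map (Nat.mul p) (sieve ps n)).
Proof.
  intros Hps Hp.
  assert (Hp2 := natprime_ge2 p (Hps p (or_introl eq_refl))).
  assert (Hps' : forall r, In r ps -> natprime r) by (intros; apply Hps; now right).
  apply NoDup_Permutation.
  - apply NoDup_filter, NoDup_sieve.
  - apply FinFun.Injective_map_NoDup; [intros a b; nia|apply NoDup_sieve].
  - intros k; rewrite filter_In in_map_iff divb_spec; [|lia].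
    rewrite in_sieve; trivial.
    split.
    + intros [[Hk Hr] [k' ->]]; exists k'; split; [lia|].
      apply in_sieve; trivial; split; [nia|].
      intros r Hr' Hd; apply (Hr r Hr'). now apply Nat.divide_mul_l.
    + intros [k' [<- Hk']]; apply in_sieve in Hk'; trivial.
      destruct Hk' as [Hk' Hr]; split; [split; [nia|]|exists k'; lia].
      intros r Hr' Hd. apply natprime_mult in Hd; [|auto].
      destruct Hd as [Hd|Hd]; [|now apply (Hr r Hr')].
      apply natprime_divide_prime in Hd; auto; [|apply Hps; now left].
      subst; contradiction.
Qed.

(** One step of inclusion-exclusion: the multiples of [p] that are struck out form a rescaled sieve
    by the remaining primes. *)
Lemma sum_over_sieve_cons (f : nat -> R) p ps n :
  (forall r, In r (p :: ps) -> natprime r) -> ~ In p ps ->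
  sum_over f (sieve (p :: ps) (p * n)) =
  sum_over f (sieve ps (p * n)) - sum_over (fun k => f (p * k)%nat) (sieve ps n).
Proof.
  intros Hps Hp.
  rewrite (sum_over_filter_split f (divb p) (sieve ps (p * n))).
  rewrite (sum_over_perm _ _ _ (sieve_multiples p ps n Hps Hp)) sum_over_map.
  unfold sieve at 1; simpl. unfold sieve at 2. rewrite list_filter_filter.
  lra.
Qed.

Lemma divide_cofactor p ps n :
  (forall r, In r (p :: ps) -> natprime r) -> ~ In p ps ->
  (forall r, In r (p :: ps) -> Nat.divide r (p * n)) ->
  forall r, In r ps -> Nat.divide r n.
Proof.
  intros Hps Hp Hd r Hr.
  destruct (natprime_mult r p n) as [H|H]; trivial.
  - apply Hps; now right.
  - apply Hd; now right.
  - apply natprime_divide_prime in H; [subst; contradiction| |]; apply Hps; simpl; auto.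
Qed.

(** Each prime replaces a sum by the difference of two sums of the same kind, at scales [p * n'] and
    [n'], since [p k / (p n') = k / n']; the bound doubles each time. The smaller scales are why the
    hypothesis ranges over all [N]. *)
Lemma sieve_sum_bound (g : R -> R) (L : R) :
  (forall N, (1 <= N)%nat -> Rabs (sum_over (fun k => g (INR k / INR N)) (seq 0 N)) <= L) ->
  forall ps n, NoDup ps -> (forall r, In r ps -> natprime r) ->
    (1 <= n)%nat -> (forall r, In r ps -> Nat.divide r n) ->
    Rabs (sum_over (fun k => g (INR k / INR n)) (sieve ps n)) <= 2 ^ length ps * L.
Proof.
  intros HL ps; induction ps as [|p ps IH]; intros n Hnd Hps Hn Hd.
  - unfold sieve; simpl.
    replace (filter (fun _ => true) (seq 0 n)) with (seq 0 n).
    + rewrite Rmult_1_l; auto.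
    + generalize (seq 0 n) as l; induction l as [|a l IHl]; simpl; congruence.
  - inversion Hnd as [|? ? Hp Hnd']; subst.
    destruct (Hd p (or_introl eq_refl)) as [n' Hn'].
    rewrite Nat.mul_comm in Hn'; subst n.
    assert (Hp2 := natprime_ge2 p (Hps p (or_introl eq_refl))).
    rewrite sum_over_sieve_cons; trivial.
    assert (H1 := IH (p * n')%nat Hnd' (fun r h => Hps r (or_intror h)) Hn
                   (fun r h => Hd r (or_intror h))).
    assert (H2 := IH n' Hnd' (fun r h => Hps r (or_intror h)) ltac:(nia)
                   (divide_cofactor p ps n' Hps Hp Hd)).
    rewrite (sum_over_ext_in (fun k => g (INR (p * k) / INR (p * n')))
               (fun k => g (INR k / INR n'))).
    + simpl length; simpl pow.
      match goal with |- Rabs (?a - ?b) <= _ =>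
        pose proof (Rabs_triang a (- b)) as H3; rewrite Rabs_Ropp in H3 end.
      unfold Rminus; lra.
    + intros k _; f_equal. rewrite !mult_INR; field.
      split; apply not_0_INR; nia.
Qed.

Definition prodR (l : list R) : R := fold_right Rmult 1 l.

(** The same recursion applied to the constant 1 produces the Euler product. The second conjunct,
    that distinct primes dividing [n] have product at most [n], follows the same descent to the
    cofactor. *)
Lemma sieve_count ps : forall n,
  NoDup ps -> (forall r, In r ps -> natprime r) ->
  (1 <= n)%nat -> (forall r, In r ps -> Nat.divide r n) ->
  INR (length (sieve ps n)) = INR n * prodR (map (fun p => 1 - / INR p) ps) /\
  prodR (map INR ps) <= INR n.
Proof.
  induction ps as [|p ps IH]; intros n Hnd Hps Hn Hd.
  - unfold sieve; simpl. split; [|apply (le_INR 1); lia].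
    replace (filter (fun _ => true) (seq 0 n)) with (seq 0 n).
    + rewrite length_seq; lra.
    + generalize (seq 0 n) as l; induction l as [|a l IHl]; simpl; congruence.
  - inversion Hnd as [|? ? Hp Hnd']; subst.
    destruct (Hd p (or_introl eq_refl)) as [n' Hn'].
    rewrite Nat.mul_comm in Hn'; subst n.
    assert (Hp2 := natprime_ge2 p (Hps p (or_introl eq_refl))).
    destruct (IH (p * n')%nat Hnd' (fun r h => Hps r (or_intror h)) Hn
                   (fun r h => Hd r (or_intror h))) as [H1 _].
    destruct (IH n' Hnd' (fun r h => Hps r (or_intror h)) ltac:(nia)
                   (divide_cofactor p ps n' Hps Hp Hd)) as [H2 H3].
    assert (Hp0 : 0 < INR p) by (apply lt_0_INR; lia).
    split.
    + rewrite -(Rmult_1_r (INR (length _))) -(sum_over_const 1).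
      rewrite sum_over_sieve_cons; trivial.
      rewrite !sum_over_const H1 H2 mult_INR; simpl; field; lra.
    + simpl; rewrite mult_INR. apply Rmult_le_compat_l; lra.
Qed.

(** * Prime factors and a lower bound for Euler's function *)

Definition prime_factors (n : nat) : list nat :=
  filter (fun p => if prime_dec (Z.of_nat p) then divb p n else false) (seq 1 n).

Lemma in_prime_factors n p : (1 <= n)%nat ->
  In p (prime_factors n) <-> natprime p /\ Nat.divide p n.
Proof.
  intros Hn; unfold prime_factors; rewrite filter_In in_seq.
  destruct (prime_dec (Z.of_nat p)) as [Hp|Hp].
  - assert (H2 := natprime_ge2 p Hp). rewrite divb_spec; [|lia].
    split; [tauto|]. intros [_ H]; split; trivial.
    assert (p <= n)%nat by (apply Nat.divide_pos_le; [lia|trivial]). lia.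
  - split; [intros [_ H]; discriminate|intros [H _]; contradiction].
Qed.

Lemma NoDup_prime_factors n : NoDup (prime_factors n).
Proof. apply NoDup_filter, seq_NoDup. Qed.

Lemma sieve_units_list ps n : (1 <= n)%nat ->
  (forall p, In p ps <-> natprime p /\ Nat.divide p n) ->
  sieve ps n = units_list n.
Proof.
  intros Hn Hps. unfold units_list.
  assert (Hpr : forall p, In p ps -> natprime p) by (intros; now apply Hps).
  unfold sieve; apply filter_ext_in; intros k Hk.
  apply Bool.eq_true_iff_eq. rewrite Nat.eqb_eq.
  assert (Hin := in_sieve ps n k Hpr).
  unfold sieve in Hin; rewrite filter_In in Hin.
  apply in_seq in Hk as Hk'.
  transitivity (forall p, In p ps -> ~ Nat.divide p k).
  - split; intros H; apply Hin; [tauto|]; split; [lia|trivial].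
  - split.
    + intros H. destruct (Nat.eq_dec (Nat.gcd k n) 0) as [E|E].
      * apply Nat.gcd_eq_0 in E; lia.
      * destruct (Nat.eq_dec (Nat.gcd k n) 1) as [|E1]; trivial.
        destruct (exists_natprime_divisor (Nat.gcd k n)) as [p [Hp Hd]]; [lia|].
        elim (H p).
        -- apply Hps; split; trivial. eapply Nat.divide_trans; [exact Hd|apply Nat.gcd_divide_r].
        -- eapply Nat.divide_trans; [exact Hd|apply Nat.gcd_divide_l].
    + intros H p Hp Hd. apply Hps in Hp as [Hp Hpn].
      assert (H1 : Nat.divide p 1) by (rewrite -H; now apply Nat.gcd_greatest).
      apply Nat.divide_1_r in H1; apply natprime_ge2 in Hp; lia.
Qed.

Lemma prodR_mult {A} (f g : A -> R) l :
  prodR (map (fun a => f a * g a) l) = prodR (map f l) * prodR (map g l).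
Proof. induction l as [|a l IH]; simpl; [lra|rewrite IH; ring]. Qed.

Lemma prodR_le {A} (f g : A -> R) l :
  (forall a, In a l -> 0 <= f a <= g a) ->
  0 <= prodR (map f l) <= prodR (map g l).
Proof.
  induction l as [|a l IH]; simpl; intros H; [lra|].
  destruct (H a (or_introl eq_refl)) as [Ha1 Ha2].
  destruct IH as [H1 H2]; [auto|]. split; [nra|]. apply Rmult_le_compat; trivial.
Qed.

(** In a list without repetition the factor [c] occurs at most once. *)
Lemma prodR_indicator (a : nat) (c : R) l : 0 <= c <= 1 -> NoDup l ->
  c <= prodR (map (fun p => if Nat.eq_dec p a then c else 1) l).
Proof.
  intros Hc; induction l as [|b l IH]; intros Hnd; simpl; [lra|].
  inversion Hnd as [|? ? Hb Hnd']; subst.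
  destruct (Nat.eq_dec b a) as [->|].
  - replace (prodR _) with 1; [lra|]. clear - Hb.
    induction l as [|b l IH]; simpl; trivial.
    simpl in Hb. destruct (Nat.eq_dec b a); [tauto|]. rewrite -IH; [lra|tauto].
  - rewrite Rmult_1_l; auto.
Qed.

(* [(p - 1)^2 / (4 p) >= 1] as soon as [p >= 6]; the constant is the product of the
   values at 2, 3, 4 and 5. *)
Lemma prodR_local_factor ps : NoDup ps -> (forall p, In p ps -> (2 <= p)%nat) ->
  / 54 <= prodR (map (fun p => (INR p - 1) ^ 2 / (4 * INR p)) ps).
Proof.
  intros Hnd Hps.
  pose (ind := fun a c (p : nat) => if Nat.eq_dec p a then c else 1).
  assert (H := prodR_le
    (fun p => (ind 2%nat (1/8) p * ind 3%nat (1/3) p) * (ind 4%nat (9/16) p * ind 5%nat (4/5) p))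
    (fun p => (INR p - 1) ^ 2 / (4 * INR p)) ps).
  rewrite (prodR_mult (fun p => ind 2%nat (1/8) p * ind 3%nat (1/3) p)) in H.
  rewrite (prodR_mult (ind 2%nat (1/8))) (prodR_mult (ind 4%nat (9/16))) in H.
  assert (H2 : 1/8 <= prodR (map (ind 2%nat (1/8)) ps)) by (apply prodR_indicator; trivial; lra).
  assert (H3 : 1/3 <= prodR (map (ind 3%nat (1/3)) ps)) by (apply prodR_indicator; trivial; lra).
  assert (H4 : 9/16 <= prodR (map (ind 4%nat (9/16)) ps)) by (apply prodR_indicator; trivial; lra).
  assert (H5 : 4/5 <= prodR (map (ind 5%nat (4/5)) ps)) by (apply prodR_indicator; trivial; lra).
  eapply Rle_trans; [|apply H].
  - apply Rle_trans with ((1/8 * (1/3)) * (9/16 * (4/5))); [lra|].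
    repeat (apply Rmult_le_compat; try lra).
  - intros p Hp; apply Hps in Hp. unfold ind.
    destruct (Nat.eq_dec p 2) as [->|]; [simpl; lra|].
    destruct (Nat.eq_dec p 3) as [->|]; [simpl; lra|].
    destruct (Nat.eq_dec p 4) as [->|]; [simpl; lra|].
    destruct (Nat.eq_dec p 5) as [->|]; [simpl; lra|].
    split; [lra|].
    assert (H6 := le_INR 6 p ltac:(lia)). simpl (INR 6) in H6.
    refine (proj1 (Rle_div_r _ _ _ _) _); [lra|]. assert (0 <= INR p * (INR p - 6)) by (apply Rmult_le_pos; lra).
    lra.
Qed.

(** This is the estimate [4^omega(n) n = O(phi(n)^2)]. With [phi(n) = n P] and [Q] the product of
    the primes dividing [n], it follows from [4^omega(n) <= 54 Q P^2] and [Q <= n]. *)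
Lemma eulerphi_lower_bound n : (1 <= n)%nat ->
  4 ^ length (prime_factors n) * INR n <= 54 * INR (eulerphi n) ^ 2.
Proof.
  intros Hn. set (ps := prime_factors n).
  assert (Hps : forall p, In p ps <-> natprime p /\ Nat.divide p n)
    by (intros; now apply in_prime_factors).
  assert (Hnd : NoDup ps) by apply NoDup_prime_factors.
  destruct (sieve_count ps n Hnd (fun r h => proj1 (proj1 (Hps r) h)) Hn
             (fun r h => proj2 (proj1 (Hps r) h))) as [H1 H2].
  rewrite (sieve_units_list ps n Hn Hps) in H1.
  unfold eulerphi; rewrite H1.
  assert (H3 := prodR_local_factor ps Hnd
     (fun p h => natprime_ge2 p (proj1 (proj1 (Hps p) h)))).
  (* Prime by prime this is [4 (p - 1)^2 / (4 p) = p (1 - 1/p)^2]. *)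
  assert (H4 : prodR (map (fun p => (INR p - 1) ^ 2 / (4 * INR p)) ps) * 4 ^ length ps
     = prodR (map INR ps) * prodR (map (fun p => 1 - / INR p) ps) ^ 2).
  { assert (Hge : forall p, In p ps -> 0 < INR p).
    { intros p Hp; apply lt_0_INR. apply Hps in Hp as [Hp _]. apply natprime_ge2 in Hp; lia. }
    clear - Hge. induction ps as [|p ps IH]; simpl; [lra|].
    assert (0 < INR p) by (apply Hge; now left).
    simpl in IH.
    match goal with |- ?a / ?b * ?c * (4 * ?d) = ?e * ?f * ?g =>
      transitivity (4 * (a / b) * (c * d)); [field; lra|] end.
    rewrite IH; [|intros; apply Hge; now right]. field; lra. }
  set (P := prodR (map (fun p => 1 - / INR p) ps)) in *.
  set (Q := prodR (map INR ps)) in *.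
  set (W := prodR (map (fun p => _ / _) ps)) in *.
  assert (0 < 4 ^ length ps) by (apply pow_lt; lra).
  assert (0 < INR n) by (apply lt_0_INR; lia).
  assert (0 <= P ^ 2) by apply pow2_ge_0.
  assert (4 ^ length ps <= 54 * (INR n * P ^ 2)).
  { apply Rle_trans with (54 * (W * 4 ^ length ps)); [nra|]. rewrite H4. nra. }
  replace (54 * (INR n * P) ^ 2) with (54 * (INR n * P ^ 2) * INR n) by ring.
  apply Rmult_le_compat_r; lra.
Qed.

(** The primes of [m * l] are those of [m] together with [l], so the two Euler products differ by
    the factor [1 - 1/l]. *)
Lemma eulerphi_mult_prime m l : (1 <= m)%nat -> natprime l -> ~ Nat.divide l m ->
  INR (eulerphi (m * l)) = (INR l - 1) * INR (eulerphi m).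
Proof.
  intros Hm Hl Hlm. set (ps := prime_factors m).
  assert (Hps : forall p, In p ps <-> natprime p /\ Nat.divide p m)
    by (intros; now apply in_prime_factors).
  assert (Hnd : NoDup ps) by apply NoDup_prime_factors.
  assert (Hl2 := natprime_ge2 l Hl).
  assert (Hps' : forall p, In p (l :: ps) <-> natprime p /\ Nat.divide p (m * l)).
  { intros p; simpl; rewrite Hps; split.
    - intros [<-|[H1 H2]]; split; trivial; [apply Nat.divide_factor_r|now apply Nat.divide_mul_l].
    - intros [H1 H2]. destruct (natprime_mult p m l H1 H2) as [H|H]; [now right|].
      left; symmetry; now apply natprime_divide_prime. }
  assert (Hnd' : NoDup (l :: ps)) by (constructor; trivial; rewrite Hps; tauto).
  destruct (sieve_count ps m Hnd (fun r h => proj1 (proj1 (Hps r) h)) Hm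
             (fun r h => proj2 (proj1 (Hps r) h))) as [H1 _].
  destruct (sieve_count (l :: ps) (m * l) Hnd' (fun r h => proj1 (proj1 (Hps' r) h)) ltac:(nia)
             (fun r h => proj2 (proj1 (Hps' r) h))) as [H2 _].
  rewrite (sieve_units_list _ _ Hm Hps) in H1.
  rewrite (sieve_units_list (l :: ps) (m * l) ltac:(nia) Hps') in H2.
  unfold eulerphi; rewrite H1 H2. simpl; rewrite mult_INR; field.
  apply not_0_INR; lia.
Qed.

(** * Riemann sums and equidistribution of reduced fractions *)

Section PeriodicLipschitz.
Variables (F : R -> R) (L : R).
Hypothesis F_periodic : forall t, F (t + 1) = F t.
Hypothesis F_lipschitz : forall a b, Rabs (F a - F b) <= L * Rabs (a - b).

Let L_ge0 : 0 <= L.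
Proof.
  assert (H := F_lipschitz 1 0). rewrite Rminus_0_r Rabs_R1 in H.
  pose proof (Rabs_pos (F 1 - F 0)); lra.
Qed.

Lemma lipschitz_continuous t : continuous F t.
Proof.
  apply continuity_pt_filterlim. intros eps Heps.
  (* The denominator is [L + 1] because [L] may vanish. *)
  exists (eps / (L + 1)). split; [apply Rdiv_lt_0_compat; lra|].
  intros u [_ Hu]. simpl in *. unfold R_dist in *.
  eapply Rle_lt_trans; [apply F_lipschitz|].
  apply Rle_lt_trans with (L * (eps / (L + 1))).
  - apply Rmult_le_compat_l; lra.
  - unfold Rdiv. rewrite -Rmult_assoc.
    refine (proj2 (Rlt_div_l _ _ _ _) _); nra.
Qed.

Lemma lipschitz_ex_RInt a b : ex_RInt F a b.
Proof. apply (ex_RInt_continuous (V := R_CompleteNormedModule)); intros; apply lipschitz_continuous. Qed.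

(** Cut the interval from 0 to [s + 1] at [s] and at 1; the leftover pieces are translates of each
    other by one period. *)
Lemma periodic_RInt s : RInt F s (s + 1) = RInt F 0 1.
Proof.
  assert (H : RInt F 1 (s + 1) = RInt F 0 s).
  { transitivity (RInt (fun t => F (t + 1)) 0 s); [|now apply RInt_ext].
    assert (H := RInt_comp_lin F 1 1 0 s (lipschitz_ex_RInt _ _)).
    replace (1 * 0 + 1) with 1 in H by ring.
    replace (1 * s + 1) with (s + 1) in H by ring.
    rewrite -H. apply RInt_ext; intros t _.
    rewrite scal_one. f_equal; ring. }
  assert (H1 := RInt_Chasles F 0 s (s + 1) (lipschitz_ex_RInt _ _) (lipschitz_ex_RInt _ _)).
  assert (H2 := RInt_Chasles F 0 1 (s + 1) (lipschitz_ex_RInt _ _) (lipschitz_ex_RInt _ _)).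
  unfold plus in *; simpl in *. lra.
Qed.

Lemma riemann_sum_step a h : 0 <= h -> Rabs (h * F a - RInt F a (a + h)) <= L * h ^ 2.
Proof.
  intros Hh.
  replace (h * F a - RInt F a (a + h)) with (- RInt (fun t => F t - F a) a (a + h)).
  - rewrite Rabs_Ropp. replace (L * h ^ 2) with ((a + h - a) * (L * h)) by ring.
    apply abs_RInt_le_const; [lra| |].
    + apply: ex_RInt_minus; [apply lipschitz_ex_RInt|apply ex_RInt_const].
    + intros t Ht. eapply Rle_trans; [apply F_lipschitz|].
      apply Rmult_le_compat_l; [exact L_ge0|]. rewrite Rabs_pos_eq; lra.
  - rewrite (RInt_minus F (fun _ => F a));
      [|apply lipschitz_ex_RInt|apply ex_RInt_const].
    rewrite RInt_const. unfold minus, plus, opp, scal; simpl; unfold mult; simpl. ring.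
Qed.

Lemma riemann_sum_partial s h K : 0 <= h ->
  Rabs (sum_over (fun k => h * F (s + INR k * h)) (seq 0 K) - RInt F s (s + INR K * h))
    <= INR K * (L * h ^ 2).
Proof.
  intros Hh; induction K as [|K IH].
  - simpl. rewrite Rmult_0_l Rplus_0_r RInt_point. unfold sum_over, zero; simpl.
    rewrite Rminus_0_r Rabs_R0; lra.
  - rewrite seq_S sum_over_app S_INR.
    assert (H := RInt_Chasles F s (s + INR K * h) (s + (INR K + 1) * h)
       (lipschitz_ex_RInt _ _) (lipschitz_ex_RInt _ _)).
    assert (H1 := riemann_sum_step (s + INR K * h) h Hh).
    replace (s + INR K * h + h) with (s + (INR K + 1) * h) in H1 by ring.
    rewrite -H. unfold plus; simpl. unfold sum_over at 2; simpl.
    match type of IH with Rabs ?a <= _ => match type of H1 with Rabs ?b <= _ =>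
      pose proof (Rabs_triang a b) as H2;
      match goal with |- Rabs ?c <= _ => replace c with (a + b) by ring end
    end end. lra.
Qed.

(** The [N] cells of width [1/N] each contribute an error [L / N^2]; after multiplication by [N] the
    total is [L], whatever [N] and [s]. This uniformity is what the sieve consumes. *)
Lemma riemann_sum_periodic s N : (1 <= N)%nat ->
  Rabs (sum_over (fun k => F (s + INR k / INR N) - RInt F 0 1) (seq 0 N)) <= L.
Proof.
  intros HN. assert (HN0 : 0 < INR N) by (apply lt_0_INR; lia).
  assert (H0 : 0 < / INR N) by now apply Rinv_0_lt_compat.
  assert (H := riemann_sum_partial s (/ INR N) N (Rlt_le _ _ H0)).
  rewrite sum_over_scal Rinv_r in H; [|lra]. rewrite periodic_RInt in H.
  replace (sum_over _ (seq 0 N)) with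
    (INR N * (/ INR N * sum_over (fun k => F (s + INR k * / INR N)) (seq 0 N) - RInt F 0 1)).
  - rewrite Rabs_mult (Rabs_pos_eq (INR N)); [|lra].
    apply Rle_trans with (INR N * (INR N * (L * (/ INR N) ^ 2))).
    + apply Rmult_le_compat_l; lra.
    + right; field; lra.
  - unfold Rminus at 2. rewrite sum_over_plus sum_over_const length_seq.
    unfold Rdiv. field; lra.
Qed.

Lemma eulerphi_pos n : (1 <= n)%nat -> 0 < INR (eulerphi n).
Proof.
  intros Hn. apply lt_0_INR. destruct (eulerphi n) eqn:E; [|lia].
  assert (H := eulerphi_lower_bound n Hn). rewrite E in H; simpl in H.
  assert (0 < 4 ^ length (prime_factors n)) by (apply pow_lt; lra).
  assert (0 < INR n) by (apply lt_0_INR; lia). nra.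
Qed.

(** Sieving by the primes of [n] leaves an error [2^omega(n) L / phi(n)], which the lower bound on
    [phi] makes at most [L sqrt(54 / n)]. The threshold is uniform in [s], since in the application
    the translation varies with [n]. *)
Lemma units_equidistribution eps : 0 < eps ->
  exists N, forall n, (N <= n)%nat -> (1 <= n)%nat -> forall s,
    Rabs (/ INR (eulerphi n) * sum_over (fun k => F (s + INR k / INR n)) (units_list n)
            - RInt F 0 1) < eps.
Proof.
  intros Heps.
  destruct (nfloor_ex (54 * L ^ 2 / eps ^ 2)) as [N HN].
  { refine (proj1 (Rle_div_r _ _ _ _) _); [nra|]. pose proof (pow2_ge_0 L); lra. }
  exists (S N); intros n HnN Hn s.
  assert (Hphi := eulerphi_pos n Hn).
  assert (HnR : 54 * L ^ 2 < INR n * eps ^ 2).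
  { refine (proj1 (Rlt_div_l _ _ _ _) _); [nra|]. apply Rlt_le_trans with (INR N + 1); [apply HN|].
    rewrite -S_INR; now apply le_INR. }
  assert (Hlow := eulerphi_lower_bound n Hn).
  assert (Hbd := sieve_sum_bound (fun t => F (s + t) - RInt F 0 1) L
     (riemann_sum_periodic s) (prime_factors n) n (NoDup_prime_factors n)
     (fun r h => proj1 (proj1 (in_prime_factors n r Hn) h)) Hn
     (fun r h => proj2 (proj1 (in_prime_factors n r Hn) h))).
  rewrite (sieve_units_list _ _ Hn (fun r => in_prime_factors n r Hn)) in Hbd.
  unfold Rminus at 1 in Hbd. rewrite sum_over_plus sum_over_const in Hbd.
  fold (eulerphi n) in Hbd.
  set (S := sum_over _ _) in *. set (I := RInt F 0 1) in *.
  set (phi := INR (eulerphi n)) in *. set (w := length (prime_factors n)) in *.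
  replace (/ phi * S - I) with (/ phi * (S + phi * - I)) by (field; lra).
  rewrite Rabs_mult (Rabs_pos_eq (/ phi)); [|left; now apply Rinv_0_lt_compat].
  rewrite Rmult_comm. refine (proj2 (Rlt_div_l _ _ _ _) _); [exact Hphi|].
  eapply Rle_lt_trans; [exact Hbd|].
  assert (Hw : 0 < 2 ^ w) by (apply pow_lt; lra).
  replace 4 with (2 * 2) in Hlow by ring. rewrite Rpow_mult_distr in Hlow.
  (* Both sides are squared and multiplied by [n], to bring in [4^w n <= 54 phi^2] and then
     [54 L^2 < n eps^2]. *)
  apply Rsqr_incrst_0; [|nra|nra]. rewrite !Rsqr_pow2.
  assert (HnR0 : 0 < INR n) by (apply lt_0_INR; lia).
  apply Rmult_lt_reg_r with (INR n); [trivial|].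
  apply Rle_lt_trans with (54 * L ^ 2 * phi ^ 2).
  - replace ((2 ^ w * L) ^ 2 * INR n) with (2 ^ w * 2 ^ w * INR n * L ^ 2) by ring.
    replace (54 * L ^ 2 * phi ^ 2) with (54 * phi ^ 2 * L ^ 2) by ring.
    apply Rmult_le_compat_r; [apply pow2_ge_0|exact Hlow].
  - replace ((eps * phi) ^ 2 * INR n) with (INR n * eps ^ 2 * phi ^ 2) by ring.
    apply Rmult_lt_compat_r; [nra|exact HnR].
Qed.

End PeriodicLipschitz.

Lemma continuous_periodic_bounded (f : R -> R) :
  (forall t (k : Z), f (t + IZR k) = f t) -> (forall t, continuous f t) ->
  exists M, forall t, Rabs (f t) <= M.
Proof.
  intros Hper Hc.
  destruct (continuity_ab_maj (fun t => Rabs (f t)) 0 1 ltac:(lra)) as [M [HM _]].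
  - intros c _. apply continuity_pt_filterlim.
    apply (continuous_comp f Rabs); [apply Hc|apply continuous_Rabs].
  - exists (Rabs (f M)). intros t.
    rewrite -(Hper t (- Int_part t)%Z) opp_IZR.
    apply HM. destruct (base_Int_part t); lra.
Qed.

(** The derivative inherits the periodicity, hence is bounded, and the mean value theorem
    applies. *)
Lemma periodic_C1_lipschitz (f : R -> R) :
  (forall t (k : Z), f (t + IZR k) = f t) ->
  (forall t, ex_derive f t) -> (forall t, continuous (Derive f) t) ->
  exists L, forall a b, Rabs (f a - f b) <= L * Rabs (a - b).
Proof.
  intros Hper Hd Hc.
  destruct (continuous_periodic_bounded (Derive f)) as [L HL]; trivial.
  - intros t k.
    transitivity (Derive (fun u => f (u + IZR k)) t).
    + symmetry; apply is_derive_unique. evar_last.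
      * apply (is_derive_comp f (fun u => u + IZR k)).
        -- apply Derive_correct, Hd.
        -- auto_derive; trivial.
      * unfold scal; simpl; unfold mult; simpl; ring.
    + now apply Derive_ext.
  - exists L; intros a b.
    destruct (MVT_gen f b a (Derive f)) as [c [_ Hc']].
    + intros; apply Derive_correct, Hd.
    + intros; apply continuity_pt_filterlim. apply: ex_derive_continuous. apply Hd.
    + rewrite Hc' Rabs_mult. apply Rmult_le_compat_r; [apply Rabs_pos|apply HL].
Qed.

(** * The primitive points *)

Definition Gamma_invariant (Psi : R * R -> R) : Prop :=
  forall a b c d, inSL2Z a b c d -> forall z, inH z -> Psi (act a b c d z) = Psi z.

Lemma Gamma_invariant_translate Psi x y k : Gamma_invariant Psi -> 0 < y ->
  Psi (x + IZR k, y) = Psi (x, y).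
Proof.
  intros HG Hy. rewrite -(HG 1 k 0 1 ltac:(unfold inSL2Z; ring) (x, y) Hy)%Z.
  f_equal; unfold act; simpl. f_equal; field.
Qed.

(* [gamma] sending [a/b + iy] to [u/b + i/(b^2 y)] has bottom row [(b, -a)], so that
   [gamma z = u/b - 1/(b (b z - a))] with [b z - a = i b y]. *)
Lemma rational_flip_matrix (a b u : Z) : (0 < b)%Z -> (b | u * a + 1)%Z ->
  exists v, inSL2Z u v b (- a) /\
    forall y, 0 < y -> act u v b (- a) (IZR a / IZR b, y) = (IZR u / IZR b, / (IZR b ^ 2 * y)).
Proof.
  intros Hb [k Hk]. exists (- k)%Z. split; [unfold inSL2Z; lia|].
  intros y Hy. assert (0 < IZR b) by now apply IZR_lt.
  unfold act; simpl fst; simpl snd. rewrite !opp_IZR.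
  replace (IZR b * (IZR a / IZR b) + - IZR a) with 0 by (field; lra).
  f_equal; field; repeat split; try lra; nra.
Qed.

Lemma Gamma_invariant_flip Psi (a b u : Z) y :
  Gamma_invariant Psi -> (0 < b)%Z -> (b | u * a + 1)%Z -> 0 < y ->
  Psi (IZR a / IZR b, y) = Psi (IZR u / IZR b, / (IZR b ^ 2 * y)).
Proof.
  intros HG Hb Hdiv Hy. destruct (rational_flip_matrix a b u Hb Hdiv) as [v [Hv Hact]].
  rewrite -Hact; trivial. symmetry; now apply HG.
Qed.

Lemma exists_neg_inverse (a b : Z) : rel_prime a b -> exists u, (b | u * a + 1)%Z.
Proof.
  intros H; apply rel_prime_bezout in H as [u v H]. exists (- u)%Z, v. lia.
Qed.

Lemma horocycle_lipschitz Psi Y : 0 < Y -> CcInf_M Psi ->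
  exists L, forall a b, Rabs (Psi (a, Y) - Psi (b, Y)) <= L * Rabs (a - b).
Proof.
  intros HY [HG [Hs _]].
  apply (periodic_C1_lipschitz (fun t => Psi (t, Y))).
  - intros t k; now apply Gamma_invariant_translate.
  - intros t; exact (proj1 (Hs nil t Y HY)).
  (* The word [false :: nil] selects the partial derivative in [x]; its joint continuity is
     restricted to the horizontal line at height [Y]. *)
  - intros t. destruct (Hs (cons false nil) t Y HY) as [_ [_ Hc]].
    intros P [eps HP]. destruct (Hc eps) as [dl Hdl].
    exists dl; intros u Hu. apply HP. apply Hdl; [exact Hu|].
    rewrite Rminus_diag Rabs_R0; apply cond_pos.
Qed.

Lemma in_units_list n j : In j (units_list n) <-> (j < n)%nat /\ Nat.gcd j n = 1%nat.
Proof. unfold units_list; rewrite filter_In in_seq Nat.eqb_eq. intuition lia. Qed.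

Lemma NoDup_units_list n : NoDup (units_list n).
Proof. apply NoDup_filter, seq_NoDup. Qed.

Lemma gcd1_rel_prime a b : Nat.gcd a b = 1%nat <-> rel_prime (Z.of_nat a) (Z.of_nat b).
Proof.
  split.
  - intros H. apply Zgcd_1_rel_prime.
    assert (Hg := Z.gcd_nonneg (Z.of_nat a) (Z.of_nat b)).
    assert (H1 : Nat.divide (Z.to_nat (Z.gcd (Z.of_nat a) (Z.of_nat b))) 1).
    { rewrite -H. apply Nat.gcd_greatest; apply divide_Z_nat; rewrite Z2Nat.id; trivial;
        [apply Z.gcd_divide_l|apply Z.gcd_divide_r]. }
    apply Nat.divide_1_r in H1; lia.
  - intros [_ _ H]. apply Nat.divide_1_r, divide_Z_nat.
    apply H; apply divide_Z_nat; [apply Nat.gcd_divide_l|apply Nat.gcd_divide_r].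
Qed.

Lemma divide_gcd1 n k : Nat.divide n (k + 1) -> Nat.gcd k n = 1%nat.
Proof.
  intros H. apply Nat.divide_1_r.
  apply (Nat.divide_add_cancel_r _ k); [apply Nat.gcd_divide_l|].
  eapply Nat.divide_trans; [apply Nat.gcd_divide_r|exact H].
Qed.

Lemma gcd1_divide a b n : Nat.divide a b -> Nat.gcd b n = 1%nat -> Nat.gcd a n = 1%nat.
Proof.
  intros H Hb. apply Nat.divide_1_r. rewrite -Hb.
  apply Nat.gcd_greatest; [|apply Nat.gcd_divide_r].
  eapply Nat.divide_trans; [apply Nat.gcd_divide_l|exact H].
Qed.

(** * Negative inverses modulo n and the flip of the primitive points *)

Definition neg_inverse (n u j : nat) : nat :=
  hd 0%nat (filter (fun k => divb n (u * j * k + 1)) (seq 0 n)).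

(** Coprimality makes the filtered list nonempty, so the default value 0 of [hd] is never taken. *)
Lemma neg_inverse_spec n u j : (1 <= n)%nat -> Nat.gcd (u * j) n = 1%nat ->
  (neg_inverse n u j < n)%nat /\ Nat.divide n (u * j * neg_inverse n u j + 1).
Proof.
  intros Hn Hg. unfold neg_inverse.
  set (l := filter _ _).
  assert (Hl : l <> nil).
  { apply gcd1_rel_prime, exists_neg_inverse in Hg as [v Hv].
    (* The Bezout coefficient [v] is an arbitrary integer; its residue modulo [n] lies in the range
       searched. *)
    assert (In (Z.to_nat (v mod Z.of_nat n)) l).
    { assert (Hb := Z.mod_pos_bound v (Z.of_nat n) ltac:(lia)).
      apply filter_In; split; [apply in_seq; lia|].
      apply divb_spec; [lia|]. apply divide_Z_nat.
      rewrite Nat2Z.inj_add [Z.of_nat (u * j * _)]Nat2Z.inj_mul Z2Nat.id; [|lia].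
      destruct Hv as [w Hw]. exists (w - Z.of_nat (u * j) * (v / Z.of_nat n))%Z.
      rewrite Z.mod_eq; [|lia]. rewrite Z.mul_sub_distr_r -Hw. change (Z.of_nat 1) with 1%Z. ring. }
    intros E; rewrite E in H; contradiction. }
  assert (H : In (hd 0%nat l) l) by (destruct l; [congruence|now left]).
  apply filter_In in H as [H1 H2]. apply in_seq in H1. apply divb_spec in H2; [|lia].
  split; [lia|exact H2].
Qed.

Lemma neg_inverse_unit n u j : (1 <= n)%nat -> Nat.gcd (u * j) n = 1%nat ->
  In (neg_inverse n u j) (units_list n).
Proof.
  intros Hn Hg. destruct (neg_inverse_spec n u j Hn Hg) as [H1 H2].
  apply in_units_list; split; trivial.
  apply divide_gcd1 in H2. eapply gcd1_divide; [|exact H2]. apply Nat.divide_factor_r.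
Qed.

Lemma gcd1_mult a b n : Nat.gcd a n = 1%nat -> Nat.gcd b n = 1%nat ->
  Nat.gcd (a * b) n = 1%nat.
Proof.
  rewrite !gcd1_rel_prime Nat2Z.inj_mul. intros Ha Hb.
  apply rel_prime_sym, rel_prime_mult; now apply rel_prime_sym.
Qed.

Lemma divide_eq_mod n a b : (a < n)%nat -> (b < n)%nat ->
  (Z.of_nat n | Z.of_nat a - Z.of_nat b)%Z -> a = b.
Proof. intros Ha Hb [k Hk]. assert (k = 0)%Z by nia. nia. Qed.

(** The congruence [u j k = -1] is symmetric in [j] and [k], and [u k] can be cancelled modulo [n].
    Hence reindexing by [neg_inverse] permutes the units. *)
Lemma neg_inverse_involutive n u j : (1 <= n)%nat -> Nat.gcd u n = 1%nat ->
  In j (units_list n) -> neg_inverse n u (neg_inverse n u j) = j.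
Proof.
  intros Hn Hu Hj. apply in_units_list in Hj as [Hj Hgj].
  destruct (neg_inverse_spec n u j Hn (gcd1_mult _ _ _ Hu Hgj)) as [H1 H2].
  assert (H3 := neg_inverse_unit n u j Hn (gcd1_mult _ _ _ Hu Hgj)).
  apply in_units_list in H3 as [_ H3].
  assert (Huk := gcd1_mult _ _ _ Hu H3).
  destruct (neg_inverse_spec n u _ Hn Huk) as [H4 H5].
  set (k := neg_inverse n u j) in *. set (i := neg_inverse n u k) in *.
  apply (divide_eq_mod n); trivial.
  apply (Gauss _ (Z.of_nat (u * k))); [|apply rel_prime_sym; now apply gcd1_rel_prime].
  apply divide_Z_nat in H2 as [a Ha]. apply divide_Z_nat in H5 as [b Hb].
  exists (b - a)%Z. rewrite Z.mul_sub_distr_r -Ha -Hb. lia.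
Qed.

Lemma sum_over_neg_inverse (f : nat -> R) n u : (1 <= n)%nat -> Nat.gcd u n = 1%nat ->
  sum_over (fun j => f (neg_inverse n u j)) (units_list n) = sum_over f (units_list n).
Proof.
  intros Hn Hu. rewrite -sum_over_map. symmetry; apply sum_over_perm.
  apply NoDup_Permutation_bis; [apply NoDup_units_list|now rewrite length_map|].
  intros j Hj. apply in_map_iff. exists (neg_inverse n u j).
  split; [now apply neg_inverse_involutive|].
  apply neg_inverse_unit; trivial. apply gcd1_mult; trivial. now apply in_units_list in Hj.
Qed.

Lemma primitive_sum_flip Psi (p : Z) q n c : Gamma_invariant Psi ->
  (1 <= q)%nat -> (1 <= n)%nat -> rel_prime p (Z.of_nat q) -> Nat.gcd n q = 1%nat -> 0 < c ->
  exists s, sum_over (fun j => Psi (IZR p / INR q + INR j / INR n, c / INR n ^ 2)) (units_list n)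
    = sum_over (fun j => Psi (s + INR j / INR n, / (c * INR q ^ 2))) (units_list n).
Proof.
  intros HG Hq Hn Hpq Hnq Hc.
  assert (HnqZ : rel_prime (Z.of_nat n) (Z.of_nat q)) by now apply gcd1_rel_prime.
  destruct (exists_neg_inverse (p * (Z.of_nat n * Z.of_nat n)) (Z.of_nat q)) as [be Hbe].
  { apply rel_prime_sym. repeat apply rel_prime_mult; now apply rel_prime_sym. }
  assert (Hu : Nat.gcd (q * q) n = 1%nat) by (apply gcd1_mult; now rewrite Nat.gcd_comm).
  (* The translation comes from the residue modulo [q] alone, so one [s] serves every [j]. *)
  exists (IZR be / INR q).
  rewrite -(sum_over_neg_inverse (fun j => Psi (IZR be / INR q + _, _)) n (q * q) Hn Hu).
  apply sum_over_ext_in; intros j Hj. apply in_units_list in Hj as [Hj Hgj].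
  destruct (neg_inverse_spec n (q * q) j Hn (gcd1_mult _ _ _ Hu Hgj)) as [_ H].
  set (al := neg_inverse n (q * q) j) in *.
  assert (HqR : 0 < INR q) by (apply lt_0_INR; lia).
  assert (HnR : 0 < INR n) by (apply lt_0_INR; lia).
  (* Here [p/q + j/n = (p n + j q) / (n q)]. The new numerator [al q + be n] solves the congruence
     modulo [n q] by Chinese remainders: modulo [n] the product is [q^2 j al], modulo [q] it is
     [p n^2 be]. *)
  assert (Hflip := Gamma_invariant_flip Psi
    (p * Z.of_nat n + Z.of_nat j * Z.of_nat q) (Z.of_nat n * Z.of_nat q)
    (Z.of_nat al * Z.of_nat q + be * Z.of_nat n) (c / INR n ^ 2) HG).
  rewrite !plus_IZR !mult_IZR -!INR_IZR_INZ in Hflip.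
  match type of Hflip with _ -> _ -> _ -> Psi (?a, _) = Psi (?b, ?z) =>
    replace (IZR p / INR q + INR j / INR n) with a by (field; lra);
    replace (IZR be / INR q + INR al / INR n) with b by (field; lra);
    replace (/ (c * INR q ^ 2)) with z by (field; lra)
  end.
  apply Hflip; [nia| |apply Rdiv_lt_0_compat; [lra|nra]].
  apply divide_Z_nat in H. rewrite !(Nat2Z.inj_add, Nat2Z.inj_mul) in H.
  assert (Hdn : (Z.of_nat n | (Z.of_nat al * Z.of_nat q + be * Z.of_nat n) *
                (p * Z.of_nat n + Z.of_nat j * Z.of_nat q) + 1)%Z).
  { destruct H as [a Ha].
    exists (a + Z.of_nat al * Z.of_nat q * p + be * (p * Z.of_nat n + Z.of_nat j * Z.of_nat q))%Z.
    rewrite !Z.mul_add_distr_r -Ha. ring. }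
  assert (Hdq : (Z.of_nat q | (Z.of_nat al * Z.of_nat q + be * Z.of_nat n) *
                (p * Z.of_nat n + Z.of_nat j * Z.of_nat q) + 1)%Z).
  { destruct Hbe as [a Ha].
    exists (a + Z.of_nat al * (p * Z.of_nat n + Z.of_nat j * Z.of_nat q) + be * Z.of_nat n * Z.of_nat j)%Z.
    rewrite !Z.mul_add_distr_r -Ha. ring. }
  (* As [n] and [q] are coprime, divisibility by each gives divisibility by [n q]. *)
  destruct Hdn as [a Ha]. rewrite Ha in Hdq |- *.
  rewrite (Z.mul_comm (Z.of_nat n)). apply Z.mul_divide_mono_r.
  rewrite Z.mul_comm in Hdq. apply Gauss in Hdq; trivial. now apply rel_prime_sym.
Qed.

Lemma primitive_limit Psi (p : Z) q c : CcInf_M Psi ->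
  (1 <= q)%nat -> rel_prime p (Z.of_nat q) -> 0 < c ->
  lim_along (fun n => (1 <= n)%nat /\ Nat.gcd n q = 1%nat)
    (fun n => delta_pr n (IZR p / INR q) (c / INR n ^ 2) Psi) (muY (/ (c * INR q ^ 2)) Psi).
Proof.
  intros HPsi Hq Hpq Hc eps Heps.
  assert (HG : Gamma_invariant Psi) by exact (proj1 HPsi).
  assert (HqR : 0 < INR q) by (apply lt_0_INR; lia).
  set (Y := / (c * INR q ^ 2)).
  assert (HY : 0 < Y) by (apply Rinv_0_lt_compat, Rmult_lt_0_compat; [trivial|now apply pow_lt]).
  destruct (horocycle_lipschitz Psi Y HY HPsi) as [L HL].
  destruct (units_equidistribution (fun t => Psi (t, Y)) L
     (fun t => Gamma_invariant_translate Psi t Y 1 HG HY) HL eps Heps) as [N HN].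
  exists N; intros n HNn [Hn Hnq].
  destruct (primitive_sum_flip Psi p q n c HG Hq Hn Hpq Hnq Hc) as [s Hs].
  unfold delta_pr. fold (sum_over (fun j => Psi (IZR p / INR q + INR j / INR n, c / INR n ^ 2))
    (units_list n)). rewrite Hs. now apply HN.
Qed.

(** * Compactness in the modular surface and escape to the cusp *)

(** [openH] uses Euclidean discs and [locally_2d] uses squares; the disc of radius [eps] sits inside
    the square. *)
Lemma openH_2d (U : R * R -> Prop) : (forall z, U z -> inH z) ->
  (forall z, U z -> locally_2d (fun u v => U (u, v)) (fst z) (snd z)) -> openH U.
Proof.
  intros H1 H2; split; trivial.
  intros z Hz; destruct (H2 z Hz) as [eps Heps].
  exists eps; split; [apply cond_pos|]. intros [u v] Huv; simpl in Huv.
  assert (Hlt : forall t, t ^ 2 < eps ^ 2 -> Rabs t < eps).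
  { intros t Ht. rewrite -(Rabs_pos_eq eps); [|left; apply cond_pos].
    apply Rsqr_lt_abs_0. now rewrite !Rsqr_pow2. }
  pose proof (pow2_ge_0 (u - fst z)). pose proof (pow2_ge_0 (v - snd z)).
  apply Heps; apply Hlt; lra.
Qed.

Lemma locally_2d_lt f a x y : continuity_2d_pt f x y -> f x y < a ->
  locally_2d (fun u v => f u v < a) x y.
Proof.
  intros Hf Ha. destruct (Hf (mkposreal (a - f x y) ltac:(lra))) as [d Hd].
  exists d; intros u v Hu Hv. specialize (Hd u v Hu Hv). simpl in Hd.
  apply Rabs_def2 in Hd; lra.
Qed.

Lemma locally_2d_upper_half_plane x y : 0 < y -> locally_2d (fun _ v => 0 < v) x y.
Proof.
  intros Hy. exists (mkposreal y Hy); intros u v _ Hv. simpl in Hv.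
  apply Rabs_def2 in Hv; lra.
Qed.

(** This is [|c z + d|^2], the factor by which the action divides heights. *)
Definition cocycle_norm (c d : Z) (z : R * R) : R :=
  (IZR c * fst z + IZR d) ^ 2 + (IZR c * snd z) ^ 2.

Lemma snd_act a b c d z : snd (act a b c d z) = snd z / cocycle_norm c d z.
Proof. reflexivity. Qed.

Lemma cocycle_norm_pos a b c d z : inSL2Z a b c d -> inH z -> 0 < cocycle_norm c d z.
Proof.
  unfold inSL2Z, inH, cocycle_norm; intros H Hz.
  destruct (Z.eq_dec c 0) as [->|Hc0].
  - assert (d <> 0)%Z by nia. assert (IZR d <> 0) by now apply not_0_IZR.
    rewrite !Rmult_0_l Rplus_0_l. assert (0 < IZR d ^ 2) by (apply pow2_gt_0; trivial). lra.
  - assert (IZR c <> 0) by now apply not_0_IZR.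
    assert (0 < (IZR c * snd z) ^ 2).
    { apply pow2_gt_0, Rmult_integral_contrapositive; split; lra. }
    pose proof (pow2_ge_0 (IZR c * fst z + IZR d)). lra.
Qed.

Lemma act_inH a b c d z : inSL2Z a b c d -> inH z -> inH (act a b c d z).
Proof.
  intros H Hz. unfold inH; rewrite snd_act.
  apply Rdiv_lt_0_compat; trivial. now apply (cocycle_norm_pos a b).
Qed.

Lemma list_nat_bound (l : list nat) : exists N, forall n, In n l -> (n <= N)%nat.
Proof.
  exists (list_max l). intros n Hn.
  assert (H := proj1 (list_max_le l (list_max l)) (le_n _)).
  rewrite Forall_forall in H; auto.
Qed.

(** The sets where [|Psi| < n] are open, invariant and increasing in [n], so finitely many, hence
    one, contain the support set [K]. *)
Lemma compact_support_bounded Psi : CcInf_M Psi ->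
  exists B, forall z, inH z -> Rabs (Psi z) <= B.
Proof.
  intros [HG [Hs [K [[HKinv HK] Hsupp]]]].
  destruct (HK nat (fun n z => inH z /\ Rabs (Psi z) < INR n)) as [l Hl].
  - intros n; split.
    + apply openH_2d; [tauto|]. intros [x y] [Hz Hn]; simpl in *.
      apply locally_2d_and; [now apply locally_2d_upper_half_plane|].
      apply (locally_2d_lt (fun u v => Rabs (Psi (u, v)))); trivial.
      intros eps. destruct (Hs nil x y Hz) as [_ [_ Hc]].
      destruct (Hc eps) as [d Hd]. exists d; intros u v Hu Hv.
      eapply Rle_lt_trans; [apply Rabs_triang_inv2|]. now apply Hd.
    + split; [tauto|]. intros a b c d H z Hz. rewrite HG; trivial.
      split; [tauto|]. intros [_ H1]; split; trivial.
      now apply act_inH.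
  - intros z Hz. apply HKinv in Hz. destruct (nfloor_ex (Rabs (Psi z)) (Rabs_pos _)) as [n Hn].
    exists (S n). rewrite S_INR; tauto.
  - destruct (list_nat_bound l) as [N HN]. exists (INR N).
    intros z Hz. destruct (Classical_Prop.classic (K z)) as [HKz|HKz].
    + destruct (Hl z HKz) as [n [Hn [_ Hlt]]]. apply HN, le_INR in Hn. lra.
    + rewrite Hsupp; trivial. rewrite Rabs_R0; apply pos_INR.
Qed.

(** The cocycle relation for [c z + d] under composition, in squared modulus. *)
Lemma cocycle_norm_act c d a0 b0 c0 d0 z : inSL2Z a0 b0 c0 d0 -> inH z ->
  cocycle_norm c d (act a0 b0 c0 d0 z) * cocycle_norm c0 d0 z
    = cocycle_norm (c * a0 + d * c0) (c * b0 + d * d0) z.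
Proof.
  intros H Hz. assert (HN := cocycle_norm_pos a0 b0 c0 d0 z H Hz).
  destruct z as [x y]. unfold cocycle_norm, act in *; cbn [fst snd] in *.
  rewrite !plus_IZR !mult_IZR.
  assert (Hdet : IZR a0 * IZR d0 - IZR b0 * IZR c0 = 1)
    by (rewrite -!mult_IZR -minus_IZR; now f_equal).
  set (N := (IZR c0 * x + IZR d0) ^ 2 + (IZR c0 * y) ^ 2) in *.
  (* The imaginary part is written back as that of [(a0 z + b0) / (c0 z + d0)] by inserting the
     determinant; what remains is an identity of rational functions. *)
  replace (y / N) with
    ((IZR a0 * y * (IZR c0 * x + IZR d0) - (IZR a0 * x + IZR b0) * (IZR c0 * y)) / N).
  - unfold N; field. fold N; lra.
  - f_equal. transitivity (y * (IZR a0 * IZR d0 - IZR b0 * IZR c0)); [ring|rewrite Hdet; ring].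
Qed.

(** For [T > 0], the points whose orbit meets the open strip of heights between [1/T] and [T],
    written without division. These sets serve as an invariant open exhaustion against which
    compactness is tested. *)
Definition thick_part (T : R) (z : R * R) : Prop :=
  inH z /\ exists a b c d, inSL2Z a b c d /\
    snd z < T * cocycle_norm c d z /\ cocycle_norm c d z < T * snd z.

Lemma thick_part_invariant T : Gamma_invariant_set (thick_part T).
Proof.
  split; [now intros z [Hz _]|].
  intros a0 b0 c0 d0 H0 z Hz.
  assert (HN := cocycle_norm_pos a0 b0 c0 d0 z H0 Hz).
  assert (Hscale : forall c d,
    (snd (act a0 b0 c0 d0 z) < T * cocycle_norm c d (act a0 b0 c0 d0 z) <->
     snd z < T * cocycle_norm (c * a0 + d * c0) (c * b0 + d * d0) z) /\
    (cocycle_norm c d (act a0 b0 c0 d0 z) < T * snd (act a0 b0 c0 d0 z) <->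
     cocycle_norm (c * a0 + d * c0) (c * b0 + d * d0) z < T * snd z)).
  { intros c d. rewrite -(cocycle_norm_act c d a0 b0); trivial. rewrite snd_act.
    set (N := cocycle_norm c0 d0 z) in *. set (M := cocycle_norm c d _).
    split.
    - rewrite -Rmult_assoc. exact (Rlt_div_l _ _ _ HN).
    - replace (T * (snd z / N)) with (T * snd z / N) by (field; lra).
      symmetry; exact (Rlt_div_r _ _ _ HN). }
  split.
  - intros [_ [a [b [c [d [H [H1 H2]]]]]]]. split; trivial.
    apply Hscale in H1; apply Hscale in H2.
    (* With [gamma] and [gamma0] the two matrices at hand, the witness is the product
       [gamma gamma0]. *)
    exists (a * a0 + b * c0)%Z, (a * b0 + b * d0)%Z, (c * a0 + d * c0)%Z, (c * b0 + d * d0)%Z.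
    split; [|now split]. unfold inSL2Z in *.
    transitivity ((a * d - b * c) * (a0 * d0 - b0 * c0))%Z; [ring|rewrite H H0; reflexivity].
  - intros [_ [a [b [c [d [H [H1 H2]]]]]]]. split; [now apply act_inH|].
    (* The witness is [gamma gamma0^-1]; [Ec] and [Ed] say that multiplying it by [gamma0] restores
       the bottom row of [gamma]. *)
    exists (a * d0 - b * c0)%Z, (b * a0 - a * b0)%Z, (c * d0 - d * c0)%Z, (d * a0 - c * b0)%Z.
    unfold inSL2Z in *. split.
    { transitivity ((a * d - b * c) * (a0 * d0 - b0 * c0))%Z; [ring|rewrite H H0; reflexivity]. }
    assert (Ec : ((c * d0 - d * c0) * a0 + (d * a0 - c * b0) * c0)%Z = c)
      by (transitivity (c * (a0 * d0 - b0 * c0))%Z; [ring|rewrite H0; ring]).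
    assert (Ed : ((c * d0 - d * c0) * b0 + (d * a0 - c * b0) * d0)%Z = d)
      by (transitivity (d * (a0 * d0 - b0 * c0))%Z; [ring|rewrite H0; ring]).
    split; apply Hscale; rewrite Ec Ed; trivial.
Qed.

Lemma cocycle_norm_continuous c d x y :
  continuity_2d_pt (fun u v => cocycle_norm c d (u, v)) x y.
Proof.
  unfold cocycle_norm; simpl.
  repeat (apply continuity_2d_pt_plus || apply continuity_2d_pt_mult ||
    apply continuity_2d_pt_const || apply continuity_2d_pt_id1 || apply continuity_2d_pt_id2).
Qed.

Lemma thick_part_open T : openH (thick_part T).
Proof.
  apply openH_2d; [now intros z [Hz _]|].
  intros [x y] [Hz [a [b [c [d [H [H1 H2]]]]]]]; simpl in *.
  assert (Hc := cocycle_norm_continuous c d x y).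
  assert (L1 : locally_2d (fun u v => v - T * cocycle_norm c d (u, v) < 0) x y).
  { apply (locally_2d_lt (fun u v => v - T * cocycle_norm c d (u, v))); [|lra].
    apply continuity_2d_pt_minus; [apply continuity_2d_pt_id2|].
    apply continuity_2d_pt_mult; [apply continuity_2d_pt_const|exact Hc]. }
  assert (L2 : locally_2d (fun u v => cocycle_norm c d (u, v) - T * v < 0) x y).
  { apply (locally_2d_lt (fun u v => cocycle_norm c d (u, v) - T * v)); [|lra].
    apply continuity_2d_pt_minus; [exact Hc|].
    apply continuity_2d_pt_mult; [apply continuity_2d_pt_const|apply continuity_2d_pt_id2]. }
  assert (L3 := locally_2d_and _ _ _ _ (locally_2d_upper_half_plane x y Hz)
    (locally_2d_and _ _ _ _ L1 L2)).
  destruct L3 as [e He]. exists e. intros u v Hu Hv.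
  destruct (He u v Hu Hv) as [K1 [K2 K3]].
  split; [exact K1|]. exists a, b, c, d. simpl. repeat split; trivial; lra.
Qed.

(** If [c = 0] then [gamma] preserves the height, which is below [T]. Otherwise
    [|c z + d|^2 >= y^2], and the lower bound [1/T] on the height of [gamma z] forces
    [y^2 < T y]. *)
Lemma thick_part_height T z : thick_part T z -> snd z <= T.
Proof.
  intros [Hz [a [b [c [d [H [H1 H2]]]]]]]. unfold inH in Hz. unfold inSL2Z in H.
  unfold cocycle_norm in *. destruct (Z.eq_dec c 0) as [->|Hc].
  - assert (Hd : (d * d = 1)%Z) by (destruct (Z.mul_eq_1 d a) as [-> | ->]; lia).
    apply (f_equal IZR) in Hd; rewrite mult_IZR in Hd.
    replace ((0 * fst z + IZR d) ^ 2 + (0 * snd z) ^ 2) with (IZR d * IZR d) in H1 by ring.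
    rewrite Hd in H1; lra.
  - assert (Hc2 : (1 <= c * c)%Z) by nia.
    apply IZR_le in Hc2; rewrite mult_IZR in Hc2.
    pose proof (pow2_ge_0 (IZR c * fst z + IZR d)).
    assert (Hlt : snd z * snd z < T * snd z).
    { eapply Rle_lt_trans; [|exact H2].
      apply Rle_trans with (IZR c * IZR c * (snd z * snd z)); [|lra].
      rewrite -{1}(Rmult_1_l (snd z * snd z)). apply Rmult_le_compat_r; nra. }
    left. now apply (Rmult_lt_reg_r (snd z)).
Qed.

Lemma compactM_height_bound K : compactM K -> exists T, 0 < T /\ forall z, K z -> snd z <= T.
Proof.
  intros [[HKH _] HK].
  destruct (HK nat (fun n => thick_part (INR n))) as [l Hl].
  - intros n; split; [apply thick_part_open|apply thick_part_invariant].
  - intros z Hz. apply HKH in Hz. unfold inH in Hz.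
    destruct (nfloor_ex (snd z + / snd z)) as [n Hn].
    { assert (0 < / snd z) by now apply Rinv_0_lt_compat. lra. }
    (* The identity matrix suffices: [y] lies between [1/T] and [T] once [T] exceeds [y + 1/y]. *)
    exists (S n). split; trivial. exists 1%Z, 0%Z, 0%Z, 1%Z.
    rewrite S_INR. unfold inSL2Z, cocycle_norm.
    assert (0 < / snd z) by now apply Rinv_0_lt_compat.
    repeat split.
    + replace ((0 * fst z + 1) ^ 2 + (0 * snd z) ^ 2) with 1 by ring. lra.
    + replace ((0 * fst z + 1) ^ 2 + (0 * snd z) ^ 2) with (/ snd z * snd z) by (field; lra).
      apply Rmult_lt_compat_r; lra.
  - destruct (list_nat_bound l) as [N HN]. exists (INR N + 1).
    split; [pose proof (pos_INR N); lra|].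
    intros z Hz. destruct (Hl z Hz) as [n [Hn Hth]].
    apply thick_part_height in Hth. apply HN, le_INR in Hn. lra.
Qed.

(** Reduce [A/B] to [a/b]. By invariance [K] also contains the flipped point, of height [1/(b^2 y)],
    so this is at most [T]; finally [b <= B]. *)
Lemma rational_height K T (A B : Z) y : compactM K -> (forall z, K z -> snd z <= T) ->
  0 < y -> (0 < B)%Z -> K (IZR A / IZR B, y) -> 1 <= T * (IZR B ^ 2 * y).
Proof.
  intros [[_ HKinv] _] HT Hy HB HKz.
  assert (HB0 : 0 < IZR B) by now apply IZR_lt.
  set (g := Z.gcd A B).
  assert (Hg : (0 < g)%Z).
  { assert (H := Z.gcd_nonneg A B). fold g in H.
    assert (g <> 0)%Z by (intros E; apply Z.gcd_eq_0_r in E; lia). lia. }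
  destruct (Z.gcd_divide_l A B) as [a Ha]. destruct (Z.gcd_divide_r A B) as [b Hb].
  fold g in Ha, Hb.
  assert (Hb0 : (0 < b)%Z) by nia.
  assert (Hab : rel_prime a b).
  { apply Zgcd_1_rel_prime. assert (H := Z.gcd_div_gcd A B g ltac:(lia) eq_refl).
    replace (A / g)%Z with a in H by (rewrite Ha Z.div_mul; lia).
    now replace (B / g)%Z with b in H by (rewrite Hb Z.div_mul; lia). }
  destruct (exists_neg_inverse a b Hab) as [u Hu].
  destruct (rational_flip_matrix a b u Hb0 Hu) as [v [Hv Hact]].
  assert (Hg1 : 1 <= IZR g) by (apply IZR_le; lia).
  assert (Hb1 : 0 < IZR b) by now apply IZR_lt.
  assert (HE : IZR A / IZR B = IZR a / IZR b).
  { rewrite Ha Hb !mult_IZR. field; lra. }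
  rewrite HE in HKz.
  apply (HKinv _ _ _ _ Hv) in HKz; [|exact Hy]. rewrite Hact in HKz; trivial.
  apply HT in HKz; simpl snd in HKz.
  assert (Hb2 : 0 < IZR b ^ 2 * y) by (apply Rmult_lt_0_compat; [now apply pow_lt|trivial]).
  assert (H1 : 1 <= T * (IZR b ^ 2 * y)).
  { apply (Rmult_le_compat_r (IZR b ^ 2 * y)) in HKz; [|lra]. rewrite Rinv_l in HKz; lra. }
  assert (HT0 : 0 < T).
  { eapply Rlt_le_trans; [|exact HKz]. now apply Rinv_0_lt_compat. }
  eapply Rle_trans; [exact H1|]. apply Rmult_le_compat_l; [lra|].
  apply Rmult_le_compat_r; [lra|]. rewrite Hb mult_IZR. apply pow_incr. split; [lra|].
  rewrite -{1}(Rmult_1_r (IZR b)). apply Rmult_le_compat_l; lra.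
Qed.

Lemma horocycle_points_escape (p : Z) (q : nat) (y : nat -> R) K :
  (1 <= q)%nat -> (forall n, (1 <= n)%nat -> 0 < y n) ->
  is_lim_seq (fun n => INR n ^ 2 * y n) 0 -> compactM K ->
  exists N, forall n, (N <= n)%nat -> forall j, (j < n)%nat ->
    ~ K (IZR p / INR q + INR j / INR n, y n).
Proof.
  intros Hq Hy Hlim HK.
  destruct (compactM_height_bound K HK) as [T [HT0 HT]].
  assert (HqR : 0 < INR q) by (apply lt_0_INR; lia).
  assert (Hc : 0 < T * INR q ^ 2) by (apply Rmult_lt_0_compat; [trivial|now apply pow_lt]).
  assert (Heps : 0 < / (T * INR q ^ 2)) by now apply Rinv_0_lt_compat.
  apply is_lim_seq_spec in Hlim. destruct (Hlim (mkposreal _ Heps)) as [N HN].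
  exists N; intros n Hn j Hj HKz.
  (* The bound [j < n] excludes [n = 0]. *)
  assert (HnR : 0 < INR n) by (apply lt_0_INR; lia).
  specialize (HN n Hn). simpl in HN. apply Rabs_def2 in HN as [HN _].
  replace (IZR p / INR q + INR j / INR n) with
    (IZR (p * Z.of_nat n + Z.of_nat j * Z.of_nat q) / IZR (Z.of_nat n * Z.of_nat q)) in HKz.
  - apply (rational_height K T) in HKz; trivial; [|apply Hy; lia|nia].
    rewrite mult_IZR -!INR_IZR_INZ in HKz.
    apply (Rmult_lt_compat_l (T * INR q ^ 2)) in HN; trivial.
    rewrite Rminus_0_r Rinv_r in HN; [|lra].
    apply (Rlt_irrefl 1). eapply Rle_lt_trans; [exact HKz|].
    eapply Rle_lt_trans; [|exact HN]. right; simpl; ring.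
  - rewrite plus_IZR !mult_IZR -!INR_IZR_INZ. field; lra.
Qed.

(** * All points: sorting by the gcd *)

Lemma sum_over_partition {A} (key : A -> nat) (f : A -> R) l ds : NoDup ds ->
  sum_over f l =
  sum_over (fun d => sum_over f (filter (fun a => Nat.eqb (key a) d) l)) ds
  + sum_over f (filter (fun a => negb (existsb (Nat.eqb (key a)) ds)) l).
Proof.
  induction ds as [|d ds IH]; intros Hnd.
  - unfold sum_over at 2; simpl. rewrite Rplus_0_l. f_equal.
    induction l as [|a l IHl]; simpl; congruence.
  - inversion Hnd as [|? ? Hd Hnd']; subst.
    rewrite sum_over_cons IH; trivial.
    rewrite (sum_over_filter_split f (fun a => Nat.eqb (key a) d)
      (filter (fun a => negb (existsb (Nat.eqb (key a)) ds)) l)) !list_filter_filter.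
    replace (filter (fun a => andb (Nat.eqb (key a) d) _) l)
      with (filter (fun a => Nat.eqb (key a) d) l).
    + replace (filter (fun a => negb (existsb (Nat.eqb (key a)) (d :: ds))) l)
        with (filter (fun a => andb (negb (Nat.eqb (key a) d))
                (negb (existsb (Nat.eqb (key a)) ds))) l); [lra|].
      apply filter_ext; intros a; simpl. now rewrite Bool.negb_orb.
    + apply filter_ext; intros a. destruct (Nat.eqb_spec (key a) d) as [E|]; trivial.
      simpl. symmetry; apply Bool.negb_true_iff, Bool.not_true_iff_false.
      rewrite existsb_exists; intros [e [He Hae]]. apply Nat.eqb_eq in Hae. congruence.
Qed.

(** Division by [d] turns gcd [d] into gcd 1. For [n = 1] the only unit is 0, which accounts for
    [j = 0]. *)
Lemma gcd_fiber d n : (1 <= d)%nat ->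
  Permutation (filter (fun j => Nat.eqb (Nat.gcd j (d * n)) d) (seq 0 (d * n)))
              (map (Nat.mul d) (units_list n)).
Proof.
  intros Hd. apply NoDup_Permutation.
  - apply NoDup_filter, seq_NoDup.
  - apply FinFun.Injective_map_NoDup; [intros a b; nia|apply NoDup_units_list].
  - intros j. rewrite filter_In in_map_iff in_seq Nat.eqb_eq. split.
    + intros [Hj Hg]. assert (H : Nat.divide d j) by (rewrite -Hg; apply Nat.gcd_divide_l).
      destruct H as [k ->]. exists k; split; [lia|]. apply in_units_list.
      rewrite Nat.mul_comm Nat.gcd_mul_mono_l in Hg. nia.
    + intros [k [<- Hk]]. apply in_units_list in Hk as [Hk Hg].
      rewrite Nat.gcd_mul_mono_l Hg. nia.
Qed.

Lemma in_divisors_list m d : (1 <= m)%nat ->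
  In d (divisors_list m) <-> (1 <= d)%nat /\ Nat.divide d m.
Proof.
  intros Hm. unfold divisors_list; rewrite filter_In in_seq. split.
  - intros [H1 H2]; split; [lia|]. apply (divb_spec d m); [lia|exact H2].
  - intros [H1 H2]. split; [apply Nat.divide_pos_le in H2; lia|].
    apply (divb_spec d m); [lia|exact H2].
Qed.

(** If [l] does not divide [j], then [gcd(j, m l)] is prime to [l] and so divides [m], and [j] is
    counted in one of the fibers. The terms left over are multiples of [l], at most [m] of them
    below [m l]. *)
Lemma sum_over_seq_mult_prime (f : nat -> R) B m l :
  (1 <= m)%nat -> natprime l -> (forall j, Rabs (f j) <= B) ->
  Rabs (sum_over f (seq 0 (m * l)) -
        sum_over (fun d => sum_over (fun k => f (d * k)%nat) (units_list (m / d * l)))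
          (divisors_list m)) <= INR m * B.
Proof.
  intros Hm Hl HB.
  assert (Hl2 := natprime_ge2 l Hl).
  rewrite (sum_over_partition (fun j => Nat.gcd j (m * l)) f _ (divisors_list m));
    [|apply NoDup_filter, seq_NoDup].
  rewrite (sum_over_ext_in
    (fun d => sum_over f (filter (fun a => Nat.eqb (Nat.gcd a (m * l)) d) (seq 0 (m * l))))
    (fun d => sum_over (fun k => f (d * k)%nat) (units_list (m / d * l)))).
  - match goal with |- Rabs (?a + ?b - ?a) <= _ => replace (a + b - a) with b by ring end.
    set (r := filter _ _).
    eapply Rle_trans; [apply (sum_over_abs_le f B); auto|].
    apply Rmult_le_compat_r; [eapply Rle_trans; [apply Rabs_pos|apply (HB 0%nat)]|].
    apply le_INR, Nat.le_trans with (length (map (Nat.mul l) (seq 0 m)));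
      [|rewrite length_map length_seq; lia].
    apply NoDup_incl_length; [apply NoDup_filter, seq_NoDup|].
    intros j Hj. apply filter_In in Hj as [Hj Hg]. apply in_seq in Hj.
    apply Bool.negb_true_iff, Bool.not_true_iff_false in Hg.
    rewrite existsb_exists in Hg.
    assert (Hlj : Nat.divide l j).
    { destruct (Nat.eq_dec (j mod l) 0) as [E|E]; [apply Nat.Lcm0.mod_divide; trivial|].
      assert (Hlj : ~ Nat.divide l j) by (intros H; apply Nat.Lcm0.mod_divide in H; lia).
      elim Hg. exists (Nat.gcd j (m * l)). split; [|apply Nat.eqb_refl].
      apply in_divisors_list; trivial.
      assert (Hg0 : (Nat.gcd j (m * l) <> 0)%nat) by (intros H; apply Nat.gcd_eq_0 in H; nia).
      split; [lia|].
      apply (Nat.gauss _ l m); [rewrite Nat.mul_comm; apply Nat.gcd_divide_r|].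
      apply gcd1_rel_prime, rel_prime_sym, prime_rel_prime; trivial.
      intros H; apply divide_Z_nat in H. apply Hlj.
      eapply Nat.divide_trans; [exact H|apply Nat.gcd_divide_l]. }
    destruct Hlj as [k ->]. apply in_map_iff. exists k. split; [lia|].
    apply in_seq. nia.
  - intros d Hd. apply in_divisors_list in Hd as [Hd [k ->]]; trivial.
    rewrite Nat.div_mul; [|lia]. replace (k * d * l)%nat with (d * (k * l))%nat by lia.
    rewrite (sum_over_perm _ _ _ (gcd_fiber d (k * l) Hd)). apply sum_over_map.
Qed.

(** Adding [k] permutes the residues modulo [n], and the integer carried is absorbed by the
    periodicity of [h]. *)
Lemma sum_over_shift (h : R -> R) (k : Z) n : (1 <= n)%nat ->
  (forall t (i : Z), h (t + IZR i) = h t) ->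
  sum_over (fun j => h (IZR k / INR n + INR j / INR n)) (seq 0 n)
    = sum_over (fun j => h (INR j / INR n)) (seq 0 n).
Proof.
  intros Hn Hh.
  assert (HnR : 0 < INR n) by (apply lt_0_INR; lia).
  set (s := fun j => Z.to_nat ((k + Z.of_nat j) mod Z.of_nat n)).
  rewrite (sum_over_perm (fun j => h (INR j / INR n)) (seq 0 n) (map s (seq 0 n))).
  - rewrite sum_over_map. apply sum_over_ext_in; intros j _.
    assert (Hb := Z.mod_pos_bound (k + Z.of_nat j) (Z.of_nat n) ltac:(lia)).
    unfold s. rewrite (INR_IZR_INZ (Z.to_nat _)) Z2Nat.id; [|lia].
    rewrite -(Hh (IZR ((k + Z.of_nat j) mod Z.of_nat n) / INR n)
                 ((k + Z.of_nat j) / Z.of_nat n)%Z).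
    f_equal. assert (E := Z.div_mod (k + Z.of_nat j) (Z.of_nat n) ltac:(lia)).
    apply (f_equal IZR) in E. rewrite !plus_IZR mult_IZR -!INR_IZR_INZ in E.
    transitivity ((IZR k + INR j) / INR n); [field; lra|]. rewrite E; field; lra.
  - apply NoDup_Permutation_bis; [apply seq_NoDup|now rewrite length_map|].
    intros j Hj. apply in_seq in Hj. apply in_map_iff.
    exists (Z.to_nat ((Z.of_nat j - k) mod Z.of_nat n)).
    assert (Hb := Z.mod_pos_bound (Z.of_nat j - k) (Z.of_nat n) ltac:(lia)).
    split; [|apply in_seq; lia].
    unfold s. rewrite Z2Nat.id; [|lia]. rewrite Zplus_mod_idemp_r.
    replace (k + (Z.of_nat j - k))%Z with (Z.of_nat j) by ring.
    rewrite Z.mod_small; lia.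
Qed.

(* Primes dividing both [m] and [q] occur in [q] to at most their power in [m], so
   removing [gcd m q] from the denominator makes it prime to [m]. *)
Lemma inNq_cofactor m q q2 : (1 <= m)%nat -> inNq q m ->
  q = (Nat.gcd m q * q2)%nat -> Nat.gcd m q2 = 1%nat.
Proof.
  unfold inNq; intros Hm HN Hq. set (g := Nat.gcd m q) in *. set (r := Nat.gcd m q2).
  assert (Hg : g <> 0%nat) by (intros E; apply Nat.gcd_eq_0 in E; lia).
  assert (H1 : Nat.divide (g * r) q) by (rewrite Hq; apply Nat.mul_divide_mono_l, Nat.gcd_divide_r).
  assert (H2 : Nat.divide (g * r) (m * m)).
  { apply Nat.divide_trans with (m * r)%nat.
    - apply Nat.mul_divide_mono_r, Nat.gcd_divide_l.
    - apply Nat.mul_divide_mono_l, Nat.gcd_divide_l. }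
  assert (H3 : Nat.divide (g * r) g).
  { apply Nat.gcd_greatest; [|exact H1].
    eapply Nat.divide_trans; [|exact HN]. now apply Nat.gcd_greatest. }
  destruct H3 as [k Hk]. assert (k * r = 1)%nat by nia. now apply Nat.mul_eq_1 in H.
Qed.

Lemma fraction_split p q1 q2 : (1 <= q1)%nat -> (1 <= q2)%nat -> Nat.gcd q1 q2 = 1%nat ->
  rel_prime p (Z.of_nat (q1 * q2)) ->
  exists p1 p2, rel_prime p2 (Z.of_nat q2) /\
    IZR p / INR (q1 * q2) = IZR p1 / INR q1 + IZR p2 / INR q2.
Proof.
  intros H1 H2 H12 Hp. apply gcd1_rel_prime, rel_prime_bezout in H12 as [u v Huv].
  (* Divide [u q1 + v q2 = 1] by [q1 q2] and multiply by [p]. The same relation makes [u] prime to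
     [q2]. *)
  exists (p * v)%Z, (p * u)%Z.
  assert (H1R : 0 < INR q1) by (apply lt_0_INR; lia).
  assert (H2R : 0 < INR q2) by (apply lt_0_INR; lia).
  split.
  - apply rel_prime_sym, rel_prime_mult.
    + apply rel_prime_sym. rewrite Nat2Z.inj_mul in Hp.
      apply rel_prime_sym, (rel_prime_div _ _ (Z.of_nat q2)) in Hp;
        [now apply rel_prime_sym|now exists (Z.of_nat q1)].
    + apply rel_prime_sym, bezout_rel_prime.
      apply (Bezout_intro _ _ _ (Z.of_nat q1) v). lia.
  - rewrite mult_INR !mult_IZR. apply (f_equal IZR) in Huv.
    rewrite plus_IZR !mult_IZR -!INR_IZR_INZ in Huv.
    transitivity (IZR p * (IZR u * INR q1 + IZR v * INR q2) / (INR q1 * INR q2));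
      [rewrite Huv|]; field; lra.
Qed.

(** * Limits along a set of indices *)

Lemma lim_along_filterlim P u L :
  lim_along P u L <-> filterlim u (within P eventually) (locally L).
Proof.
  split.
  - intros H. apply filterlim_locally. intros eps.
    destruct (H eps (cond_pos eps)) as [N HN]. exists N; intros n Hn HP. now apply HN.
  - intros H eps Heps. apply (proj1 (filterlim_locally _ _)) with (eps := mkposreal eps Heps) in H.
    destruct H as [N HN]. exists N; intros n Hn HP. now apply HN.
Qed.

Lemma lim_along_const P c : lim_along P (fun _ => c) c.
Proof. intros eps Heps; exists 0%nat; intros. rewrite Rminus_diag Rabs_R0; trivial. Qed.

Lemma lim_along_plus P u v a b : lim_along P u a -> lim_along P v b ->
  lim_along P (fun n => u n + v n) (a + b).
Proof.
  rewrite !lim_along_filterlim; intros Hu Hv.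
  exact (filterlim_comp_2 u v Rplus Hu Hv (filterlim_plus a b)).
Qed.

Lemma lim_along_mult P u v a b : lim_along P u a -> lim_along P v b ->
  lim_along P (fun n => u n * v n) (a * b).
Proof.
  rewrite !lim_along_filterlim; intros Hu Hv.
  exact (filterlim_comp_2 u v Rmult Hu Hv (filterlim_mult a b)).
Qed.

Lemma lim_along_sum {A} P (u : A -> nat -> R) (a : A -> R) l :
  (forall i, In i l -> lim_along P (u i) (a i)) ->
  lim_along P (fun n => sum_over (fun i => u i n) l) (sum_over a l).
Proof.
  induction l as [|i l IH]; intros H; [exact (lim_along_const P 0)|].
  apply (lim_along_plus P (u i) (fun n => sum_over (fun i => u i n) l)).
  - apply H; now left.
  - apply IH; intros; apply H; now right.
Qed.

Lemma lim_along_ext P u v a N : (forall n, (N <= n)%nat -> P n -> u n = v n) ->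
  lim_along P u a -> lim_along P v a.
Proof.
  intros He Hu eps Heps. destruct (Hu eps Heps) as [N' HN'].
  exists (N + N')%nat; intros n Hn HP. rewrite -He; trivial; [|lia]. apply HN'; [lia|trivial].
Qed.

Lemma lim_along_squeeze P u v w a N :
  (forall n, (N <= n)%nat -> P n -> Rabs (u n - v n) <= w n) ->
  lim_along P v a -> lim_along P w 0 -> lim_along P u a.
Proof.
  intros He Hv Hw eps Heps.
  destruct (Hv (eps / 2) ltac:(lra)) as [N1 HN1]. destruct (Hw (eps / 2) ltac:(lra)) as [N2 HN2].
  exists (N + N1 + N2)%nat; intros n Hn HP.
  specialize (He n ltac:(lia) HP). specialize (HN1 n ltac:(lia) HP). specialize (HN2 n ltac:(lia) HP).
  rewrite Rminus_0_r in HN2. pose proof (Rle_abs (w n)).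
  replace (u n - a) with ((u n - v n) + (v n - a)) by ring.
  pose proof (Rabs_triang (u n - v n) (v n - a)). lra.
Qed.

Lemma lim_along_reindex P Q u a s : lim_along Q u a ->
  (forall N, exists N', forall n, (N' <= n)%nat -> P n -> (N <= s n)%nat /\ Q (s n)) ->
  lim_along P (fun n => u (s n)) a.
Proof.
  intros Hu Hs eps Heps. destruct (Hu eps Heps) as [N HN]. destruct (Hs N) as [N' HN'].
  exists N'; intros n Hn HP. destruct (HN' n Hn HP); auto.
Qed.

Lemma lim_along_inv P c : lim_along P (fun n => c / INR n) 0.
Proof.
  assert (H : is_lim_seq (fun n => c / INR n) 0).
  { assert (H := is_lim_seq_scal_l _ c _ (is_lim_seq_inv _ _ is_lim_seq_INR ltac:(discriminate))).
    simpl in H. now rewrite Rmult_0_r in H. }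
  apply is_lim_seq_spec in H. intros eps Heps. destruct (H (mkposreal eps Heps)) as [N HN].
  exists N; intros n Hn _; now apply HN.
Qed.

(** * The limit over all points for n = ml *)

Lemma inPm_cofactor_coprime m q2 d n : (1 <= m)%nat -> (1 <= q2)%nat -> Nat.gcd m q2 = 1%nat ->
  In d (divisors_list m) -> (m * q2 + m <= n)%nat -> inPm m n ->
  exists l, natprime l /\ ~ Nat.divide l m /\ n = (m * l)%nat /\
    (n / d = m / d * l)%nat /\ Nat.gcd (n / d) q2 = 1%nat.
Proof.
  intros Hm Hq2 Hmq Hd Hn [l [Hl [Hlm ->]]].
  apply in_divisors_list in Hd as [Hd [k Hk]]; trivial.
  exists l. split; [trivial|]. split; [trivial|]. split; [trivial|]. split.
  - rewrite Hk. replace (k * d * l)%nat with (k * l * d)%nat by lia. rewrite !Nat.div_mul; lia.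
  - rewrite Hk. replace (k * d * l)%nat with (k * l * d)%nat by lia. rewrite Nat.div_mul; [|lia].
    apply gcd1_mult.
    + eapply gcd1_divide; [|exact Hmq]. exists d; lia.
    (* From [m l >= m q2 + m] comes [l > q2], so [l] cannot divide [q2]. *)
    + apply gcd1_rel_prime, prime_rel_prime; trivial. intros H. apply divide_Z_nat in H.
      apply Nat.divide_pos_le in H; nia.
Qed.

(** Since [q1] divides [n], the shift [p1/q1] is a multiple of [1/n] and only permutes the
    points. *)
Lemma delta_shift Psi p q (p1 p2 : Z) q1 q2 n y : Gamma_invariant Psi -> 0 < y ->
  (1 <= n)%nat -> Nat.divide q1 n ->
  IZR p / INR q = IZR p1 / INR q1 + IZR p2 / INR q2 ->
  delta n (IZR p / INR q) y Psi = delta n (IZR p2 / INR q2) y Psi.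
Proof.
  intros HG Hy Hn [k Hk] Hsplit. unfold delta; f_equal.
  assert (Hk0 : 0 < INR k) by (apply lt_0_INR; nia).
  assert (Hq1 : 0 < INR q1) by (apply lt_0_INR; nia).
  assert (H := sum_over_shift (fun t => Psi (IZR p2 / INR q2 + t, y)) (p1 * Z.of_nat k) n Hn).
  unfold sum_over in H. rewrite -H.
  - f_equal; apply map_ext; intros j. f_equal; f_equal.
    rewrite Hsplit Hk mult_IZR mult_INR -INR_IZR_INZ.
    replace (IZR p1 * INR k / (INR k * INR q1)) with (IZR p1 / INR q1) by (field; lra). ring.
  - intros t i. rewrite -Rplus_assoc. now apply Gamma_invariant_translate.
Qed.

(** The points with gcd [d] are the primitive points of denominator [N], with the constant [c]
    replaced by [c / d^2]. *)
Lemma units_sum_delta_pr Psi x c d N : (1 <= d)%nat -> (1 <= N)%nat ->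
  sum_over (fun k => Psi (x + INR (d * k) / INR (d * N), c / INR (d * N) ^ 2)) (units_list N)
  = INR (eulerphi N) * delta_pr N x (c / INR d ^ 2 / INR N ^ 2) Psi.
Proof.
  intros Hd HN. unfold delta_pr.
  assert (Hphi := eulerphi_pos N HN).
  rewrite -Rmult_assoc Rinv_r; [|lra]. rewrite Rmult_1_l.
  apply sum_over_ext_in; intros k _.
  assert (0 < INR d) by (apply lt_0_INR; lia).
  assert (0 < INR N) by (apply lt_0_INR; lia).
  rewrite !mult_INR. f_equal; f_equal; field; lra.
Qed.

Lemma delta_limit Psi (p : Z) q c m : CcInf_M Psi ->
  (1 <= q)%nat -> rel_prime p (Z.of_nat q) -> 0 < c -> (1 <= m)%nat -> inNq q m ->
  lim_along (inPm m) (fun n => delta n (IZR p / INR q) (c / INR n ^ 2) Psi)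
    (nuY m (INR (Nat.gcd m q) ^ 2 / (c * INR q ^ 2)) Psi).
Proof.
  intros HPsi Hq Hpq Hc Hm HNq.
  assert (HG : Gamma_invariant Psi) by exact (proj1 HPsi).
  destruct (compact_support_bounded Psi HPsi) as [B HB].
  destruct (Nat.gcd_divide_r m q) as [q2 Hq2]. rewrite Nat.mul_comm in Hq2.
  assert (Hmq2 := inNq_cofactor m q q2 Hm HNq Hq2).
  set (q1 := Nat.gcd m q) in *.
  assert (Hq1m : Nat.divide q1 m) by apply Nat.gcd_divide_l.
  assert (Hq1 : (1 <= q1)%nat) by nia. assert (Hq2' : (1 <= q2)%nat) by nia.
  destruct (fraction_split p q1 q2 Hq1 Hq2' (gcd1_divide _ _ _ Hq1m Hmq2)) as [p1 [p2 [Hp2 Hsplit]]].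
  { now rewrite -Hq2. }
  rewrite -Hq2 in Hsplit.
  assert (Hq1R : 0 < INR q1) by (apply lt_0_INR; lia).
  assert (Hq2R : 0 < INR q2) by (apply lt_0_INR; lia).
  assert (HmR : 0 < INR m) by (apply lt_0_INR; lia).
  set (x2 := IZR p2 / INR q2) in *.
  (* Compare with the sum sorted by [d = gcd(j, n)]; the discarded terms contribute at most
     [m B / n]. *)
  apply (lim_along_squeeze _ _
    (fun n => sum_over (fun d => INR (eulerphi (n / d)) / INR n
                 * delta_pr (n / d) x2 (c / INR d ^ 2 / INR (n / d) ^ 2) Psi) (divisors_list m))
    (fun n => INR m * B / INR n) _ 1).
  - intros n Hn [l [Hl [Hlm Hnl]]].
    assert (HnR : 0 < INR n) by (apply lt_0_INR; lia).
    assert (Hy : 0 < c / INR n ^ 2) by (apply Rdiv_lt_0_compat; [trivial|now apply pow_lt]).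
    rewrite (delta_shift Psi p q p1 p2 q1 q2); trivial;
      [|rewrite Hnl; now apply Nat.divide_mul_l].
    assert (H := sum_over_seq_mult_prime (fun j => Psi (x2 + INR j / INR n, c / INR n ^ 2))
      B m l Hm Hl (fun j => HB (x2 + INR j / INR n, c / INR n ^ 2) Hy)).
    replace (sum_over (fun d => _ / _ * _) _) with
      (/ INR n * sum_over (fun d => sum_over
         (fun k => Psi (x2 + INR (d * k) / INR n, c / INR n ^ 2)) (units_list (m / d * l)))
         (divisors_list m)).
    + rewrite -Hnl in H. unfold delta. fold (sum_over
        (fun j => Psi (x2 + INR j / INR n, c / INR n ^ 2)) (seq 0 n)).
      rewrite -Rmult_minus_distr_l Rabs_mult Rabs_pos_eq;
        [|left; now apply Rinv_0_lt_compat].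
      unfold Rdiv; rewrite (Rmult_comm (INR m * B)).
      apply Rmult_le_compat_l; [left; now apply Rinv_0_lt_compat|exact H].
    + rewrite -sum_over_scal. apply sum_over_ext_in; intros d Hd.
      apply in_divisors_list in Hd as [Hd [k Hk]]; trivial.
      assert (Hk0 : (1 <= k)%nat) by nia. assert (Hl2 := natprime_ge2 l Hl).
      assert (Hnd : (n = d * (k * l))%nat) by (rewrite Hnl Hk; lia).
      replace (m / d)%nat with k by (rewrite Hk Nat.div_mul; lia).
      replace (n / d)%nat with (k * l)%nat by (rewrite Hnd (Nat.mul_comm d) Nat.div_mul; lia).
      rewrite {2 3}Hnd (units_sum_delta_pr Psi x2 c d (k * l)); [|lia|nia].
      unfold Rdiv; ring.
  - unfold nuY. fold (sum_over (fun d => INR (eulerphi (m / d)) *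
      muY (INR d ^ 2 * (INR q1 ^ 2 / (c * INR q ^ 2))) Psi) (divisors_list m)).
    rewrite -sum_over_scal. apply lim_along_sum; intros d Hd.
    assert (Hcof := inPm_cofactor_coprime m q2 d).
    apply in_divisors_list in Hd as Hd'; trivial. destruct Hd' as [Hd1 [k Hk]].
    assert (HdR : 0 < INR d) by (apply lt_0_INR; lia).
    rewrite -Rmult_assoc. apply lim_along_mult.
    (* For [n = m l] the weight [phi(n/d)/n] equals [phi(m/d) (l - 1) / (m l)], that is
       [phi(m/d)/m - phi(m/d)/n]. *)
    + apply (lim_along_ext _ (fun n => / INR m * INR (eulerphi (m / d))
               + - INR (eulerphi (m / d)) / INR n) _ _ (m * q2 + m)%nat).
      * intros n Hn HP.
        destruct (Hcof n Hm Hq2' Hmq2 Hd Hn HP) as [l [Hl [Hlm [Hnl [Hnd _]]]]].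
        assert (Hl2 := natprime_ge2 l Hl). assert (0 < INR l) by (apply lt_0_INR; lia).
        replace (m / d)%nat with k in * by (rewrite Hk Nat.div_mul; lia).
        rewrite Hnd eulerphi_mult_prime; trivial; [|nia|].
        -- rewrite Hnl mult_INR. field; lra.
        -- intros H1; apply Hlm. rewrite Hk. now apply Nat.divide_mul_l.
      * rewrite -{2}(Rplus_0_r (/ INR m * _)).
        apply lim_along_plus; [apply lim_along_const|apply lim_along_inv].
    (* As [q = q1 q2], the height at [d] is the primitive limit height for denominator [q2] and
       constant [c / d^2]. *)
    + replace (INR d ^ 2 * (INR q1 ^ 2 / (c * INR q ^ 2)))
        with (/ (c / INR d ^ 2 * INR q2 ^ 2)) by (rewrite Hq2 mult_INR; field; lra).
      apply (lim_along_reindex _ _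
        (fun N => delta_pr N x2 (c / INR d ^ 2 / INR N ^ 2) Psi) _ (fun n => (n / d)%nat)
        (primitive_limit Psi p2 q2 (c / INR d ^ 2) HPsi Hq2' Hp2
           (Rdiv_lt_0_compat _ _ Hc (pow_lt _ 2 HdR)))).
      intros N. exists (m * q2 + m + d * (N + 1))%nat. intros n Hn HP.
      destruct (Hcof n Hm Hq2' Hmq2 Hd ltac:(lia) HP) as [l [_ [_ [_ [_ Hg]]]]].
      assert (N + 1 <= n / d)%nat by (apply Nat.div_le_lower_bound; lia).
      split; [lia|split; [lia|exact Hg]].
  - apply lim_along_inv.
Qed.

Theorem theorem1p3 (p : Z) (q : nat) (y : nat -> R) :
  (1 <= q)%nat -> Z.gcd p (Z.of_nat q) = 1%Z ->
  (forall n, (1 <= n)%nat -> 0 < y n) ->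
  let x := IZR p / INR q in
  (* part (1) *)
  (forall c : R, 0 < c -> (forall n, (1 <= n)%nat -> y n = c / INR n ^ 2) ->
   forall Psi : R * R -> R, CcInf_M Psi ->
     lim_along (fun n => (1 <= n)%nat /\ Nat.gcd n q = 1%nat)
               (fun n => delta_pr n x (y n) Psi) (muY (/ (c * INR q ^ 2)) Psi)
     /\
     forall m : nat, (1 <= m)%nat -> inNq q m ->
       lim_along (inPm m) (fun n => delta n x (y n) Psi)
                 (nuY m (INR (Nat.gcd m q) ^ 2 / (c * INR q ^ 2)) Psi))
  /\
  (* part (2) *)
  (is_lim_seq (fun n => INR n ^ 2 * y n) 0 ->
   forall K : R * R -> Prop, compactM K ->
     exists N : nat, forall n, (N <= n)%nat ->
       (forall j, (j < n)%nat -> ~ K (x + INR j / INR n, y n)) /\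
       (forall j, In j (units_list n) -> ~ K (x + INR j / INR n, y n))).
Proof.
  intros Hq Hpq Hy x. apply Zgcd_1_rel_prime in Hpq. split.
  - intros c Hc Hyc Psi HPsi. split.
    (* The formula for [y n] is given from [n = 1] on, whence the threshold 1. *)
    + apply (lim_along_ext _ (fun n => delta_pr n x (c / INR n ^ 2) Psi) _ _ 1);
        [|now apply primitive_limit].
      intros n Hn _. now rewrite Hyc.
    + intros m Hm HNq. apply (lim_along_ext _ (fun n => delta n x (c / INR n ^ 2) Psi) _ _ 1);
        [|now apply delta_limit].
      intros n Hn _. now rewrite Hyc.
  - intros Hlim K HK.
    destruct (horocycle_points_escape p q y K Hq Hy Hlim HK) as [N HN].
    exists N; intros n Hn. split; [now apply HN|].
    intros j Hj. apply in_units_list in Hj as [Hj _]. now apply HN.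
Qed.
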